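(* Let $r\ge2$ and $\mathbf z=(z_1,\dots,z_{r-1},1)^\intercal\in\Omega^r$. Then for any $\gamma\in\mathrm{GL}_r(A)$, \[E_r(\gamma\cdot\mathbf z)=\det(\gamma)^{-1}j(\gamma,\mathbf z)\Big(E_r(\mathbf z)(c_{11}-z_1c_{1r})+E_r^{[2]}(\mathbf z)(c_{12}-z_2c_{1r})+\dots+E_r^{[r-1]}(\mathbf z)(c_{1(r-1)}-z_{r-1}c_{1r})+\tilde\pi^{-1}c_{1r}\Big),\] where for each $1\le j\le r$, $c_{1j}$ is the $(1,j)$-cofactor of $\gamma$.
   Context: Let $q$ be a prime power, $A=\mathbb F_q[\theta]$, $|\theta|_\infty=q$, $K_\infty=\mathbb F_q((1/\theta))$, $\mathbb C_\infty$ the completion of an algebraic closure of $K_\infty$. Fix $(-\theta)^{1/(q-1)}$, $\tilde\pi=\theta(-\theta)^{1/(q-1)}\prod_{i\ge1}(1-\theta^{1-q^i})^{-1}$. A Drinfeld module of rank $r$ is $\phi:A\to\mathbb C_\infty[\tau]$ ($\tau x=x^q\tau$), $\phi_\theta=\theta+\phi_{\theta,1}\tau+\dots+\phi_{\theta,r}\tau^r$, $\phi_{\theta,r}\ne0$, with exponential whose kernel is an $A$-lattice of rank $r$; each $A$-lattice of rank $r$ arises from a unique $\phi$. $\Omega^r$: vectors $(z_1,\dots,z_r)^\intercal\in\mathbb C_\infty^r$ with $K_\infty$-linearly independent entries and $z_r=1$; $\phi^{\mathbf z}$ has lattice $Az_1+\dots+Az_r$ and $\phi^{\mathbf z}_\theta=\theta+g_1(\mathbf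 z)\tau+\dots+g_{r-1}(\mathbf z)\tau^{r-1}+\Delta_r(\mathbf z)\tau^r$ ($\Delta_r$ is nowhere zero). $\mathrm{GL}_r(A)$ acts by $\gamma\cdot\mathbf z=j(\gamma,\mathbf z)^{-1}\gamma\mathbf z$ where $j(\gamma,\mathbf z)=a_{r1}z_1+\dots+a_{rr}z_r$ for $\gamma=(a_{ij})$. Regarding $\Delta_r$ as a function of $z_1,\dots,z_{r-1}$, define $E_r(\mathbf z)=\tilde\pi^{-1}\Delta_r(\mathbf z)^{-1}\frac{\partial}{\partial z_1}\Delta_r(\mathbf z)$ and, for $2\le j\le r-1$, $E_r^{[j]}(\mathbf z)=\tilde\pi^{-1}\Delta_r(\mathbf z)^{-1}\frac{\partial}{\partial z_j}\Delta_r(\mathbf z)$. *)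

(* Defs.v *)
(* C_infty is not in any library: it is taken as a binder
   (a field C with an absolute value into a realType R) satisfying axioms
   that characterize C_infty up to isometric isomorphism. *)
From HB Require Import structures.
From mathcomp Require Import all_boot all_order all_algebra.
From mathcomp Require Import reals.
From Stdlib Require Import ClassicalEpsilon.

Set Implicit Arguments.
Unset Strict Implicit.
Unset Printing Implicit Defensive.

Import Order.TTheory GRing.Theory Num.Theory.
Local Open Scope ring_scope.

Section Drinfeld.
Variables (F : finFieldType) (C : fieldType) (R : realType).
Variables (iota : {rmorphism F -> C}) (theta : C) (absC : C -> R).

Definition qF : nat := #|F|.

Definition Aemb (a : {poly F}) : C := (map_poly iota a).[theta].

Definition cvgC (u : nat -> C) (l : C) : Prop :=
  forall e : R, 0 < e -> exists N, forall n, (N <= n)%N -> absC (u n - l) < e.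
Definition cauchyC (u : nat -> C) : Prop :=
  forall e : R, 0 < e -> exists N, forall m n, (N <= m)%N -> (N <= n)%N ->
    absC (u m - u n) < e.
Definition seriesC (u : nat -> C) (l : C) : Prop :=
  cvgC (fun N => \sum_(i < N) u i) l.

Definition algebraic_over_A (y : C) : Prop :=
  exists p : {poly {poly F}}, p != 0 /\ (map_poly Aemb p).[y] = 0.

Record is_Cinfty : Prop := {
  abs_ge0 : forall x, 0 <= absC x;
  abs_eq0 : forall x, absC x = 0 <-> x = 0;
  absM : forall x y, absC (x * y) = absC x * absC y;
  abs_ultra : forall x y, absC (x + y) <= Num.max (absC x) (absC y);
  abs_theta : absC theta = qF%:R;
  C_complete : forall u, cauchyC u -> exists l, cvgC u l;
  C_algclosed : GRing.closed_field_axiom C;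
  C_alg_dense : forall x (e : R), 0 < e ->
      exists y, algebraic_over_A y /\ absC (x - y) < e }.

Definition Kinf (x : C) : Prop :=
  exists a b : nat -> {poly F}, (forall n, Aemb (b n) != 0) /\
    cvgC (fun n => Aemb (a n) / Aemb (b n)) x.

Definition Omega (r : nat) (z : 'cV[C]_r.+1) : Prop :=
  z ord_max 0 = 1 /\
  forall c : 'I_r.+1 -> C, (forall i, Kinf (c i)) ->
    \sum_i c i * z i 0 = 0 -> forall i, c i = 0.

Definition inLattice (r : nat) (z : 'cV[C]_r.+1) (x : C) : Prop :=
  exists a : 'I_r.+1 -> {poly F}, x = \sum_i Aemb (a i) * z i 0.

(* g_1, ..., g_(r+1) are the coefficients of phi_theta for the Drinfeld
   module whose exponential has kernel the lattice of z:
   e(x) = sum_i ec_i x^(q^i) entire, ec_0 = 1, ker e = Lambda_z,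
   e(theta x) = theta e(x) + sum_(i=1)^(r+1) g_i e(x)^(q^i). *)
Definition IsDrinfeld (r : nat) (z : 'cV[C]_r.+1) (g : nat -> C) : Prop :=
  exists (e : C -> C) (ec : nat -> C),
    ec 0%N = 1 /\
    (forall x, seriesC (fun i => ec i * x ^+ (qF ^ i)) (e x)) /\
    (forall x, e x = 0 <-> inLattice z x) /\
    (forall x, e (theta * x) =
               theta * e x + \sum_(1 <= i < r.+2) g i * (e x) ^+ (qF ^ i)).

Definition drinfeld_coeffs (r : nat) (z : 'cV[C]_r.+1) : nat -> C :=
  epsilon (inhabits (fun _ => 0)) (IsDrinfeld z).

Definition Delta (r : nat) (z : 'cV[C]_r.+1) : C := drinfeld_coeffs z r.+1.

Definition is_pderiv (r : nat) (f : 'cV[C]_r.+1 -> C) (z : 'cV[C]_r.+1)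
    (j : 'I_r.+1) (d : C) : Prop :=
  forall e : R, 0 < e -> exists del : R, 0 < del /\
    forall h : C, h != 0 -> absC h < del ->
      absC ((f (z + h *: delta_mx j 0) - f z) / h - d) < e.

Definition pderiv (r : nat) (f : 'cV[C]_r.+1 -> C) (z : 'cV[C]_r.+1)
    (j : 'I_r.+1) : C :=
  epsilon (inhabits 0) (is_pderiv f z j).

(* pi tilde = theta * zeta * prod_(i>=1) (1 - theta^(1-q^i))^-1,
   zeta a fixed (q-1)-th root of -theta *)
Definition pitilde (zeta : C) : C :=
  epsilon (inhabits 0)
    (cvgC (fun N => theta * zeta *
       \prod_(1 <= i < N) (1 - (theta ^+ (qF ^ i - 1))^-1)^-1)).

(* E_r (j = 0) and E_r^[j+1] (1 <= j <= r-2, 0-indexed) *)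
Definition Ej (zeta : C) (r : nat) (z : 'cV[C]_r.+1) (j : 'I_r.+1) : C :=
  (pitilde zeta)^-1 * (Delta z)^-1 * pderiv (@Delta r) z j.

Definition jfac (r : nat) (gamma : 'M[{poly F}]_r.+1) (z : 'cV[C]_r.+1) : C :=
  (map_mx Aemb gamma *m z) ord_max 0.

Definition act (r : nat) (gamma : 'M[{poly F}]_r.+1) (z : 'cV[C]_r.+1)
  : 'cV[C]_r.+1 :=
  (jfac gamma z)^-1 *: (map_mx Aemb gamma *m z).

End Drinfeld.

(* Main.v *)
(** The discriminant is an explicit limit of products of linear forms. For a lattice with basis
    z, let E_d be the normalized polynomial vanishing on the F_q-space of combinations of the
    z_i with coefficients of degree < d; it is F_q-linear, and counting roots gives
    E_(d+1)(theta x) = phi_d(E_d(x)), phi_d being the normalized polynomial (times theta) that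
    vanishes at the values of E_d at the theta-division points. The E_d converge to the
    exponential, which gives existence; conversely any exponential e of a Drinfeld module with this
    lattice is the limit of the E_d, by comparing E_d(y) with e(y) = phi_(theta^n)(e(y/theta^n)) as
    n grows. Hence Delta(z) = theta * prod_b - 1 / e(b.z/theta) is a limit of products of linear
    forms b.z and their inverses, with b in A^r.

    The absolute value being ultrametric, the logarithmic derivative of such a product has a
    quadratic remainder that is uniform in the number of factors, so Delta is differentiable as a
    function of all r coordinates. It depends on the lattice only and is homogeneous of degree
    1 - q^r, which is 1 in C. Therefore Delta(gamma.z + h e_1) = j^(q^r - 1) Delta(z + h j w) with
    j = j(gamma,z) and w = gamma^-1 e_1, whose i-th entry is c_1i / det(gamma), and Euler's relation
    sum_i z_i d_i Delta = Delta eliminates the derivative along z_r. *)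
Require Import Defs.
From HB Require Import structures.
From mathcomp Require Import all_boot all_order all_algebra.
From mathcomp Require Import fingroup pgroup abelian finfield.
From mathcomp Require Import reals.
From mathcomp Require Import ring lra.
From Stdlib Require Import Classical ClassicalEpsilon.

Set Implicit Arguments.
Unset Strict Implicit.
Unset Printing Implicit Defensive.
Import Order.TTheory GRing.Theory Num.Theory.
Local Open Scope ring_scope.

(** * Ultrametric limits *)

Section AbsoluteValue.
Variables (F : finFieldType) (C : fieldType) (R : realType).
Variables (iota : {rmorphism F -> C}) (theta : C) (absC : C -> R).
Hypothesis HC : is_Cinfty iota theta absC.

Local Notation cvg := (cvgC absC).
Local Notation q := #|F|.

Lemma abs0 : absC 0 = 0. Proof. exact/(abs_eq0 HC). Qed.

Lemma abs_gt0 x : x != 0 -> 0 < absC x.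
Proof.
move=> x0; rewrite lt_def (abs_ge0 HC) andbT.
by apply: contra x0 => /eqP/(abs_eq0 HC) ->.
Qed.

Lemma abs_neq0 x : 0 < absC x -> x != 0.
Proof. by apply: contraTneq => ->; rewrite abs0 ltxx. Qed.

Lemma abs1 : absC 1 = 1.
Proof.
have /eqP := absM HC 1 1; rewrite mulr1 -subr_eq0 -{1}[absC 1]mulr1 -mulrBr.
rewrite mulf_eq0 gt_eqF ?abs_gt0 ?oner_eq0 //= subr_eq0 => /eqP <-.
by [].
Qed.

Lemma absX x n : absC (x ^+ n) = absC x ^+ n.
Proof. by elim: n => [|n IH]; rewrite ?expr0 ?abs1 // !exprS (absM HC) IH. Qed.

Lemma abs_unity x n : (0 < n)%N -> x ^+ n = 1 -> absC x = 1.
Proof.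
move=> n0 xn; apply/eqP; rewrite -(@pexpr_eq1 _ _ n) ?(abs_ge0 HC) //.
by rewrite -absX xn abs1.
Qed.

Lemma absN x : absC (- x) = absC x.
Proof. by rewrite -mulN1r (absM HC) (@abs_unity _ 2) ?mul1r ?sqrrN ?expr1n. Qed.

Lemma abs_distC x y : absC (x - y) = absC (y - x).
Proof. by rewrite -absN opprB. Qed.

Lemma absV x : absC x^-1 = (absC x)^-1.
Proof.
have [->|x0] := eqVneq x 0; first by rewrite invr0 abs0 invr0.
apply: (mulfI (lt0r_neq0 (abs_gt0 x0))).
by rewrite -(absM HC) !mulfV ?abs1 // lt0r_neq0 // abs_gt0.
Qed.

Lemma abs_addP x y M : absC x <= M -> absC y <= M -> absC (x + y) <= M.
Proof. by move=> hx hy; apply: le_trans (abs_ultra HC x y) _; rewrite ge_max hx. Qed.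

Lemma abs_subP x y M : absC x <= M -> absC y <= M -> absC (x - y) <= M.
Proof. by move=> hx hy; apply: abs_addP; rewrite ?absN. Qed.

Lemma abs_distP y x z M :
  absC (x - y) <= M -> absC (y - z) <= M -> absC (x - z) <= M.
Proof. by move=> h1 h2; rewrite -(subrKA y); apply: abs_addP. Qed.

Lemma abs_add_lt x y M : absC x < M -> absC y < M -> absC (x + y) < M.
Proof. by move=> hx hy; apply: le_lt_trans (abs_ultra HC x y) _; rewrite gt_max hx. Qed.

Lemma abs_dist_lt y x z M :
  absC (x - y) < M -> absC (y - z) < M -> absC (x - z) < M.
Proof. by move=> h1 h2; rewrite -(subrKA y); apply: abs_add_lt. Qed.

Lemma abs_sumP (I : Type) (s : seq I) (P : pred I) (f : I -> C) M : 0 <= M ->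
  (forall i, P i -> absC (f i) <= M) -> absC (\sum_(i <- s | P i) f i) <= M.
Proof.
move=> M0 fM; elim/big_ind: _ => // [|x y]; first by rewrite abs0.
exact: abs_addP.
Qed.

Lemma abs_addl x y : absC y < absC x -> absC (x + y) = absC x.
Proof.
move=> yx; apply/eqP; rewrite eq_le abs_addP ?(ltW yx) //= leNgt.
apply/negP => h; suff: absC x < absC x by rewrite ltxx.
by rewrite -{1}(addrK y x); apply: abs_add_lt; rewrite ?absN.
Qed.

Lemma abs_1D u : absC u < 1 -> absC (1 + u) = 1.
Proof. by move=> u1; rewrite abs_addl abs1. Qed.

Lemma abs_dist_eq x y : absC (x - y) < absC y -> absC x = absC y.
Proof. by move=> h; rewrite -{1}(subrKC y x) abs_addl. Qed.

Lemma natr_pow_gt n : (n%:R : R) < 2 ^+ n.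
Proof. by rewrite -natrX ltr_nat ltn_expl. Qed.

Lemma geom_small (x e : R) : 2 <= x -> 0 < e -> exists k, x ^- k < e.
Proof.
move=> x2 e0; exists (Num.bound e^-1); rewrite invf_plt ?posrE //.
  apply: lt_le_trans (archi_boundP _) _; first by rewrite invr_ge0 ltW.
  apply: le_trans (ltW (natr_pow_gt _)) _.
  by rewrite lerXn2r ?nnegrE // (le_trans _ x2).
by rewrite exprn_gt0 // (lt_le_trans _ x2).
Qed.

(** * Limits of sequences in [C] *)

Lemma cvg_ext u v l : (forall n, u n = v n) -> cvg u l -> cvg v l.
Proof. by move=> uv ul e e0; have [N h] := ul e e0; exists N => n; rewrite -uv; apply: h. Qed.

Lemma cvg_eventually u v l N0 :
  (forall n, (N0 <= n)%N -> u n = v n) -> cvg u l -> cvg v l.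
Proof.
move=> uv ul e e0; have [N h] := ul e e0; exists (maxn N N0) => n.
by rewrite geq_max => /andP[nN nN0]; rewrite -uv //; apply: h.
Qed.

Lemma cvg_cst l : cvg (fun=> l) l.
Proof. by move=> e e0; exists 0%N => n _; rewrite subrr abs0. Qed.

Lemma cvg_comp u l (s : nat -> nat) :
  (forall n, (n <= s n)%N) -> cvg u l -> cvg (u \o s) l.
Proof.
move=> hs ul e e0; have [N h] := ul e e0; exists N => n nN /=.
exact/h/(leq_trans nN).
Qed.

Lemma cvgD u v l m : cvg u l -> cvg v m -> cvg (fun n => u n + v n) (l + m).
Proof.
move=> ul vm e e0; have [N hu] := ul e e0; have [M hv] := vm e e0.
exists (maxn N M) => n; rewrite geq_max => /andP[nN nM].
by rewrite opprD addrACA abs_add_lt ?hu ?hv.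
Qed.

Lemma cvgN u l : cvg u l -> cvg (fun n => - u n) (- l).
Proof.
move=> ul e e0; have [N hu] := ul e e0; exists N => n nN.
by rewrite -opprD absN hu.
Qed.

Lemma cvgB u v l m : cvg u l -> cvg v m -> cvg (fun n => u n - v n) (l - m).
Proof. by move=> ul vm; apply: cvgD => //; apply: cvgN. Qed.

Lemma cvg_bounded u l : cvg u l ->
  exists2 M, 0 < M & exists N, forall n, (N <= n)%N -> absC (u n) <= M.
Proof.
move=> ul; exists (absC l + 1); first by rewrite ltr_wpDl ?(abs_ge0 HC).
have [N h] := ul 1 ltr01; exists N => n nN.
rewrite -(subrK l (u n)); apply: abs_addP; last by rewrite lerDl.
by apply: le_trans (ltW (h _ nN)) _; rewrite lerDr (abs_ge0 HC).
Qed.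

Lemma cvgM u v l m : cvg u l -> cvg v m -> cvg (fun n => u n * v n) (l * m).
Proof.
move=> ul vm e e0; have [M M0 [N1 hM]] := cvg_bounded ul.
have m0 : 0 < absC m + 1 by rewrite ltr_wpDl ?(abs_ge0 HC).
have [N2 hu] := ul _ (divr_gt0 e0 m0); have [N3 hv] := vm _ (divr_gt0 e0 M0).
exists (maxn N1 (maxn N2 N3)) => n; rewrite !geq_max => /and3P[n1 n2 n3].
apply: (@abs_dist_lt (u n * m)).
  rewrite -mulrBr (absM HC).
  apply: le_lt_trans (ler_wpM2r (abs_ge0 HC _) (hM _ n1)) _.
  by rewrite mulrC -ltr_pdivlMr // hv.
rewrite -mulrBl (absM HC).
have : absC (u n - l) * (absC m + 1) < e by rewrite -ltr_pdivlMr // hu.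
by apply: le_lt_trans; rewrite ler_wpM2l ?(abs_ge0 HC) // lerDl.
Qed.

(** The isosceles principle: once [u n] is nearer to [l] than 0 is, both have the same absolute
    value. *)
Lemma cvg_abs u l : cvg u l -> l != 0 ->
  exists N, forall n, (N <= n)%N -> absC (u n) = absC l.
Proof.
move=> ul l0; have [N h] := ul _ (abs_gt0 l0); exists N => n nN.
exact/abs_dist_eq/h.
Qed.

Lemma cvgV u l : cvg u l -> l != 0 -> cvg (fun n => (u n)^-1) l^-1.
Proof.
move=> ul l0 e e0; have [N1 h1] := cvg_abs ul l0.
have al := abs_gt0 l0.
(* Once [absC (u n) = absC l], the inverses differ by [absC (l - u n) / absC l ^+ 2]. *)
have [|N2 h2] := ul (e * absC l ^+ 2); first by rewrite mulr_gt0 ?exprn_gt0.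
exists (maxn N1 N2) => n; rewrite geq_max => /andP[n1 n2].
have un0 : u n != 0 by apply: abs_neq0; rewrite h1.
have -> : (u n)^-1 - l^-1 = (l - u n) / (u n * l) by field; rewrite un0 l0.
rewrite (absM HC) absV (absM HC) h1 // abs_distC -expr2.
by rewrite ltr_pdivrMr ?exprn_gt0 // h2.
Qed.

Lemma cvg_sum (I : Type) (s : seq I) (P : pred I) (u : I -> nat -> C) l :
  (forall i, P i -> cvg (u i) (l i)) ->
  cvg (fun n => \sum_(i <- s | P i) u i n) (\sum_(i <- s | P i) l i).
Proof.
move=> h; elim: s => [|i s IH].
  by rewrite big_nil; apply: cvg_ext (cvg_cst _) => n; rewrite big_nil.
rewrite big_cons; case: ifP => Pi.
  by apply: cvg_ext (cvgD (h i Pi) IH) => n; rewrite big_cons Pi.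
by apply: cvg_ext IH => n; rewrite big_cons Pi.
Qed.

Lemma cvg_prod (I : Type) (s : seq I) (P : pred I) (u : I -> nat -> C) l :
  (forall i, P i -> cvg (u i) (l i)) ->
  cvg (fun n => \prod_(i <- s | P i) u i n) (\prod_(i <- s | P i) l i).
Proof.
move=> h; elim: s => [|i s IH].
  by rewrite big_nil; apply: cvg_ext (cvg_cst _) => n; rewrite big_nil.
rewrite big_cons; case: ifP => Pi.
  by apply: cvg_ext (cvgM (h i Pi) IH) => n; rewrite big_cons Pi.
by apply: cvg_ext IH => n; rewrite big_cons Pi.
Qed.

Lemma eq_of_small x y : (forall e, 0 < e -> absC (x - y) <= e) -> x = y.
Proof.
move=> h; apply/eqP; rewrite -subr_eq0; apply/negPn/negP => xy.
have a0 := abs_gt0 xy.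
have /h : 0 < absC (x - y) / 2 by rewrite divr_gt0.
by rewrite ler_pdivlMr // mulrDr mulr1 gerDl leNgt a0.
Qed.

Lemma cvg_uniq u l m : cvg u l -> cvg u m -> l = m.
Proof.
move=> ul um; apply: eq_of_small => e e0.
have [N hl] := ul e e0; have [M hm] := um e e0.
apply: (@abs_distP (u (maxn N M))); apply: ltW.
  by rewrite abs_distC hl ?leq_maxl.
by rewrite hm ?leq_maxr.
Qed.

Lemma cvg_le u l M N0 : cvg u l ->
  (forall n, (N0 <= n)%N -> absC (u n) <= M) -> absC l <= M.
Proof.
move=> ul h; rewrite leNgt; apply/negP => Ml.
have M0 : 0 <= M by apply: le_trans (h _ (leqnn _)); apply: (abs_ge0 HC).
have l0 : l != 0 by apply: abs_neq0; apply: le_lt_trans Ml.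
have [N hN] := cvg_abs ul l0.
have := h _ (leq_maxl N0 N); rewrite hN ?leq_maxr // leNgt => /negP; exact.
Qed.

Lemma cvg_dist_le u l x M N0 : cvg u l ->
  (forall n, (N0 <= n)%N -> absC (u n - x) <= M) -> absC (l - x) <= M.
Proof. by move=> ul; apply: cvg_le; apply: cvgB => //; apply: cvg_cst. Qed.

Lemma cvg_cauchy u l : cvg u l -> cauchyC absC u.
Proof.
move=> ul e e0; have [N h] := ul e e0; exists N => m n Nm Nn.
by apply: (@abs_dist_lt l); rewrite 1?(abs_distC l) h.
Qed.

(** * The embedding of A = F_q[theta] and its absolute value *)

Lemma q_gt1 : (1 < q)%N. Proof. exact: card_finNzRing_gt1. Qed.

Lemma q_ge2 : (2 : R) <= q%:R. Proof. by rewrite ler_nat q_gt1. Qed.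

Lemma q_gt0R : (0 : R) < q%:R. Proof. exact: lt_le_trans q_ge2. Qed.

Lemma theta_neq0 : theta != 0.
Proof. by apply: abs_neq0; rewrite (abs_theta HC); apply: q_gt0R. Qed.

(** A nonzero constant is a root of unity of order dividing q - 1. *)
Lemma abs_iota c : c != 0 -> absC (iota c) = 1.
Proof.
move=> c0; apply: (@abs_unity _ q.-1); first by have := q_gt1; case: #|F| => [|[]].
rewrite -rmorphXn /= -(rmorph1 iota); congr (iota _).
apply: (mulfI c0); rewrite -exprS prednK; last exact: ltnW q_gt1.
by rewrite expf_card mulr1.
Qed.

Lemma abs_iota_le c : absC (iota c) <= 1.
Proof. by have [->|/abs_iota ->//] := eqVneq c 0; rewrite rmorph0 abs0. Qed.

Local Notation A := (Aemb iota theta).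

Lemma Aemb_is_additive : zmod_morphism A.
Proof. by move=> a b; rewrite /Aemb rmorphB hornerD hornerN. Qed.

Lemma Aemb_is_multiplicative : monoid_morphism A.
Proof. by split=> [|a b]; rewrite /Aemb ?rmorph1 ?hornerC // rmorphM hornerM. Qed.

HB.instance Definition _ := GRing.isZmodMorphism.Build {poly F} C A Aemb_is_additive.
HB.instance Definition _ := GRing.isMonoidMorphism.Build {poly F} C A Aemb_is_multiplicative.

Lemma AembC c : A c%:P = iota c.
Proof. by rewrite /Aemb map_polyC hornerC. Qed.

Lemma AembX : A 'X = theta.
Proof. by rewrite /Aemb map_polyX hornerX. Qed.

(** Horner induction: in [p * 'X + c] with [p] nonzero, the first term has absolute value at least q
    and dominates the constant. *)
Lemma abs_Aemb b : b != 0 -> absC (A b) = q%:R ^+ (size b).-1.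
Proof.
elim/poly_ind: b => [|p c IH]; first by rewrite eqxx.
have [->|p0 _] := eqVneq p 0.
  rewrite mul0r add0r => c0; rewrite AembC size_polyC.
  by have cn0 : c != 0; [by apply: contra c0 => /eqP ->; rewrite polyC0|rewrite abs_iota // cn0].
have ap : q%:R <= absC (A p * theta).
  rewrite (absM HC) (abs_theta HC) IH //; apply: ler_peMl; first by rewrite ler0n.
  by apply: exprn_ege1; rewrite ler1n ltnW ?q_gt1.
rewrite rmorphD rmorphM /= AembX AembC abs_addl; last first.
  apply: le_lt_trans (abs_iota_le c) _; apply: lt_le_trans ap.
  by rewrite ltr1n q_gt1.
rewrite (absM HC) IH // (abs_theta HC) size_MXaddC (negPf p0) /= -exprSr prednK //.
by rewrite size_poly_gt0.
Qed.

Lemma Aemb_eq0 b : (A b == 0) = (b == 0).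
Proof.
have [->|b0] := eqVneq b 0; first by rewrite rmorph0 eqxx.
by apply/negbTE/abs_neq0; rewrite abs_Aemb // exprn_gt0 ?q_gt0R.
Qed.

End AbsoluteValue.

(** * Polynomials with prescribed roots and F_q-linear polynomials *)

Section NormalizedProduct.
Variable C : fieldType.
Implicit Types (rs : seq C) (p : {poly C}).

(** Normalized by linear coefficient 1 rather than leading coefficient 1, so that products over
    growing pieces of a lattice can converge. The factor ['X] stands for the root 0, which [rs] is
    expected to contain. *)
Definition nprod rs : {poly C} := 'X * \prod_(x <- rs | x != 0) (1 - x^-1 *: 'X).

Lemma nprodE rs : uniq rs -> 0 \in rs ->
  nprod rs = (\prod_(x <- rs | x != 0) - x^-1) *: \prod_(x <- rs) ('X - x%:P).
Proof.
move=> urs rs0; rewrite /nprod [in RHS](bigD1_seq 0) //= subr0 scalerAr -scaler_prod.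
congr (_ * _); apply: eq_bigr => x x0.
by rewrite scalerBr !scaleNr opprK addrC -[x%:P]alg_polyC scalerA mulVf // scale1r.
Qed.

Lemma horner_nprod rs y :
  (nprod rs).[y] = y * \prod_(x <- rs | x != 0) (1 - y / x).
Proof.
rewrite /nprod hornerM hornerX horner_prod; congr (_ * _).
by apply: eq_bigr => x _; rewrite !hornerE mulrC.
Qed.

Lemma root_nprod rs y : 0 \in rs -> root (nprod rs) y = (y \in rs).
Proof.
move=> rs0; rewrite rootE horner_nprod mulf_eq0.
have [->|y0] /= := eqVneq y 0; first by rewrite rs0.
apply/eqP/idP => [/eqP|yrs].
  rewrite prodf_seq_eq0 => /hasP[x xrs /andP[x0]].
  rewrite subr_eq0 => /eqP e; suff -> : y = x by [].
  by rewrite -[x]mul1r e mulfVK.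
by rewrite (big_rem y) //= y0 divff // subrr mul0r.
Qed.

Lemma deriv_nprod rs : (nprod rs)^`().[0] = 1.
Proof.
rewrite /nprod derivM derivX mul1r hornerD hornerM hornerX mul0r addr0.
rewrite horner_prod big1 // => x _.
by rewrite hornerD hornerN hornerZ hornerX hornerC mulr0 subr0.
Qed.

Lemma lead_nprod rs : uniq rs -> 0 \in rs ->
  (nprod rs)`_(size rs) = \prod_(x <- rs | x != 0) - x^-1.
Proof.
move=> urs rs0; rewrite nprodE // coefZ.
have /monicP := monic_prod_XsubC rs predT id.
by rewrite /lead_coef size_prod_XsubC /= => ->; rewrite mulr1.
Qed.

(* [p] and [nprod rs] are proportional, and the coefficient is read off at ['X]. *)
Lemma poly_of_roots p rs : uniq rs -> 0 \in rs -> all (root p) rs ->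
  (size p <= (size rs).+1)%N -> p = p^`().[0] *: nprod rs.
Proof.
move=> urs rs0 prs sp; have [->|p0] := eqVneq p 0.
  by rewrite deriv0 horner0 scale0r.
have sp2 : size p = (size rs).+1.
  by apply/eqP; rewrite eqn_leq sp max_poly_roots.
have urs' : uniq_roots rs by rewrite uniq_rootsE.
have pE := all_roots_prod_XsubC sp2 prs urs'.
set c := \prod_(x <- rs | x != 0) - x^-1.
have c0 : c != 0.
  by rewrite prodf_seq_neq0; apply/allP => x _; apply/implyP => x0; rewrite oppr_eq0 invr_eq0.
have {}pE : p = (lead_coef p / c) *: nprod rs.
  by rewrite nprodE // -/c scalerA divfK.
by rewrite {2}pE derivZ hornerZ deriv_nprod mulr1.
Qed.

End NormalizedProduct.

(** * Spans over F_q as lists *)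

Section Span.
Variable F : finFieldType.

Section Def.
Variables (T : zmodType) (sc : F -> T -> T).

(** Combinations are listed with multiplicity, so that [uniq (spanl s)] expresses the linear
    independence of [s]. *)
Fixpoint spanl (s : seq T) : seq T :=
  if s is v :: s' then [seq w + sc c v | w <- spanl s', c <- enum F] else [:: 0].

Lemma size_spanl s : size (spanl s) = (#|F| ^ size s)%N.
Proof. by elim: s => //= v s IH; rewrite size_allpairs IH -cardE expnSr. Qed.

Lemma spanl_cons v s w c : w \in spanl s -> w + sc c v \in spanl (v :: s).
Proof. by move=> ws; apply: allpairs_f; rewrite ?mem_enum. Qed.

Lemma spanl0 s : (forall v, sc 0 v = 0) -> 0 \in spanl s.
Proof.
move=> sc0; elim: s => [|v s IH]; first exact: mem_head.
by have := spanl_cons v 0 IH; rewrite sc0 addr0.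
Qed.

End Def.

Lemma map_spanl (T T' : zmodType) (sc : F -> T -> T) (sc' : F -> T' -> T')
    (f : T -> T') s :
  f 0 = 0 -> {morph f : x y / x + y} -> (forall c v, f (sc c v) = sc' c (f v)) ->
  map f (spanl sc s) = spanl sc' (map f s).
Proof.
move=> f0 fD fsc; elim: s => [|v s IH] /=; first by rewrite f0.
rewrite -IH allpairs_mapl map_allpairs; apply: eq_allpairs => w c.
by rewrite fD fsc.
Qed.

Lemma uniq_map_inj (T1 T2 : eqType) (f : T1 -> T2) s :
  uniq (map f s) -> {in s &, injective f}.
Proof.
elim: s => //= x s IH /andP[nx us] y z.
rewrite !inE => /predU1P[->|ys] /predU1P[->|zs] // e; last exact: IH.
  by case/negP: nx; rewrite e map_f.
by case/negP: nx; rewrite -e map_f.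
Qed.

Lemma allpairs_uniql (T1 T2 T3 : eqType) (f : T1 -> T2 -> T3) s t y0 :
  y0 \in t -> uniq [seq f x y | x <- s, y <- t] -> uniq s.
Proof.
move=> yt; elim: s => //= x s IH.
rewrite cat_uniq => /and3P[_ /hasPn h /IH ->]; rewrite andbT.
apply/negP => xs; have /h/negP[] : f x y0 \in [seq f x y | x <- s, y <- t].
  exact: allpairs_f.
exact: map_f.
Qed.

Lemma uniq_spanl_cons (T : zmodType) (sc : F -> T -> T) v s :
  (forall v, sc 0 v = 0) -> sc 1 v = v ->
  uniq (spanl sc (v :: s)) -> uniq (spanl sc s) /\ v \notin spanl sc s.
Proof.
move=> sc0 sc1 /= u; split.
  by apply: (allpairs_uniql (y0 := 0)) u; rewrite mem_enum.
apply/negP => vs; move: u.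
rewrite -(map_allpairs (fun p => p.1 + sc p.2 v) pair) => /uniq_map_inj inj.
(* If [v] lies in the span of [s], then [v + 0 v] and [0 + 1 v] are one element listed at two
   places. *)
have : (v, 0) = (0, 1) :> T * F.
  apply: inj; rewrite ?allpairs_f ?mem_enum ?spanl0 //=.
  by rewrite sc0 sc1 addr0 add0r.
by case=> _ /eqP; rewrite eq_sym oner_eq0.
Qed.

End Span.

(** * F_q-linear polynomials *)

Section QPolynomials.
Variables (F : finFieldType) (C : fieldType) (iota : {rmorphism F -> C}).
Local Notation q := #|F|.
Local Notation iscale := (fun (c : F) (x : C) => iota c * x).

(** The additive group of [F] is an elementary abelian p-group, so its order is a power of p. *)
Lemma pnat_q (R : nzRingType) : [pchar R] =i [pchar F] -> [pchar R].-nat q.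
Proof.
move=> e; have [p pr_p chp] := finPcharP F.
have /abelem_pgroup := fin_ring_pchar_abelem chp.
rewrite /pgroup cardsT => h; apply: sub_in_pnat h => x _ /eqP ->.
by rewrite e.
Qed.

Lemma pchar_C : [pchar C] =i [pchar F].
Proof.
have [p pr_p chp] := finPcharP F; have chC := rmorph_pchar iota chp.
by move=> x; rewrite (pcharf_eq chp) (pcharf_eq chC).
Qed.

Lemma frobD (x y : C) i : (x + y) ^+ (q ^ i) = x ^+ (q ^ i) + y ^+ (q ^ i).
Proof. by apply: exprDn_pchar; rewrite pnatX pnat_q //; apply: pchar_C. Qed.

Lemma frobB (x y : C) i : (x - y) ^+ (q ^ i) = x ^+ (q ^ i) - y ^+ (q ^ i).
Proof. by apply/eqP; rewrite eq_sym subr_eq -frobD subrK. Qed.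

Lemma q_gt0 : (0 < q)%N. Proof. exact: ltnW (q_gt1 F). Qed.

Lemma frob_sum (I : Type) (s : seq I) (f : I -> {poly C}) :
  (\sum_(i <- s) f i) ^+ q = \sum_(i <- s) f i ^+ q.
Proof.
elim: s => [|i s IH]; first by rewrite !big_nil expr0n; case: #|F| q_gt0.
rewrite !big_cons exprDn_pchar ?IH //; apply: pnat_q => x.
by rewrite pchar_poly pchar_C.
Qed.

Lemma natq_eq0 : q%:R = 0 :> C.
Proof.
have [p pr_p chp] := finPcharP F; have chC := rmorph_pchar iota chp.
apply/eqP; rewrite -(dvdn_pcharf chC).
have := pnat_q (R := F) (fun _ => erefl); rewrite (eq_pnat _ (pcharf_eq chp)).
case/p_natP => [[|k]] // e; last by rewrite e expnS dvdn_mulr.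
by have := q_gt1 F; rewrite e.
Qed.

Lemma iota_expq c i : iota c ^+ (q ^ i) = iota c.
Proof.
elim: i => [|i IH]; first by rewrite expr1.
by rewrite expnS exprM -rmorphXn expf_card.
Qed.

Definition is_qpoly n (p : {poly C}) :=
  exists c : nat -> C, p = \sum_(i < n.+1) c i *: 'X^(q ^ i).

Lemma qpoly_hornerD n p x y : is_qpoly n p -> p.[x + y] = p.[x] + p.[y].
Proof.
case=> c ->; rewrite !horner_sum -big_split; apply: eq_bigr => i _ /=.
by rewrite !hornerZ !hornerXn frobD mulrDr.
Qed.

Lemma qpoly_horner0 n p : is_qpoly n p -> p.[0] = 0.
Proof.
by move=> h; apply: (addrI p.[0]); rewrite -(qpoly_hornerD _ _ h) !addr0.
Qed.

Lemma qpoly_hornerB n p x y : is_qpoly n p -> p.[x - y] = p.[x] - p.[y].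
Proof. by move=> h; apply/eqP; rewrite eq_sym subr_eq -(qpoly_hornerD _ _ h) subrK. Qed.

Lemma qpoly_hornerZ n p c x : is_qpoly n p -> p.[iota c * x] = iota c * p.[x].
Proof.
case=> e ->; rewrite !horner_sum mulr_sumr; apply: eq_bigr => i _ /=.
by rewrite !hornerZ !hornerXn exprMn iota_expq mulrCA.
Qed.

Lemma qpoly_coef n p : is_qpoly n p ->
  p = \sum_(i < n.+1) p`_(q ^ i) *: 'X^(q ^ i).
Proof.
case=> c pE; rewrite {1}pE; apply: eq_bigr => i _; congr (_ *: _).
rewrite pE coef_sum (bigD1 i) //= coefZ coefXn eqxx mulr1 big1 ?addr0 // => j ji.
by rewrite coefZ coefXn eqn_exp2l ?q_gt1 // (inj_eq val_inj) eq_sym (negPf ji) mulr0.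
Qed.

Lemma size_qpoly n p : is_qpoly n p -> (size p <= (q ^ n).+1)%N.
Proof.
case=> c ->; apply: (leq_trans (size_sum _ _ _)); apply/bigmax_leqP => i _.
apply: (leq_trans (size_scale_leq _ _)); rewrite size_polyXn ltnS.
by rewrite leq_exp2l ?q_gt1 // -ltnS.
Qed.

(** Induction on the generators. If [p] is the polynomial of the span of [s], then
    [p - p ^+ q / p(v)^(q-1)] also vanishes on the multiples of [v], because [p(w + c v) = c p(v)]
    and [c^q = c]. Its degree and linear coefficient identify it through [poly_of_roots]. *)
Lemma nprod_qpoly s : uniq (spanl iscale s) ->
  is_qpoly (size s) (nprod (spanl iscale s)).
Proof.
have sc0 v : iscale 0 v = 0 by rewrite rmorph0 mul0r.
elim: s => [_|v s IH us].
  exists (fun=> 1); rewrite big_ord1 scale1r expr1 /nprod big_cons eqxx big_nil.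
  by rewrite /= mulr1.
have [|us' vs] := uniq_spanl_cons sc0 _ us; first by rewrite rmorph1 mul1r.
have {us'}P := IH us'.
set p := nprod _ in P; pose b := p.[v].
have b0 : b != 0 by rewrite -rootE root_nprod // spanl0.
pose r := p - (b ^- q.-1) *: p ^+ q.
have rQ : is_qpoly (size s).+1 r.
  case: (P) => c pE.
  (* The Frobenius shifts the index by one, and the cutoff discards the values of [c] beyond
     [size s], which are arbitrary. *)
  exists (fun i => (if (i <= size s)%N then c i else 0) -
      (if i is j.+1 then b ^- q.-1 * c j ^+ q else 0)).
  rewrite (eq_bigr (fun i : 'I__ => (if (i <= size s)%N then c i else 0) *: 'X^(q ^ i) -
     (if i : nat is j.+1 then b ^- q.-1 * c j ^+ q else 0) *: 'X^(q ^ i))); last first.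
    by move=> i _; rewrite scalerBl.
  rewrite big_split sumrN /= {1}big_ord_recr /= ltnn scale0r addr0.
  rewrite [X in _ - X]big_ord_recl /= scale0r add0r.
  rewrite /r {1}pE; congr (_ - _).
    by apply: eq_bigr => i _; rewrite -ltnS ltn_ord.
  rewrite pE frob_sum scaler_sumr; apply: eq_bigr => i _.
  by rewrite exprZn -exprM -expnSr scalerA.
(* The q-th power has derivative zero, as q = 0 in [C]. *)
have r1 : r^`().[0] = 1.
  rewrite /r derivB derivZ deriv_exp -mulr_natl -polyC_natr natq_eq0 polyC0 mul0r scaler0 subr0.
  exact: deriv_nprod.
have <- // : r = nprod (spanl iscale (v :: s)).
rewrite -[RHS]scale1r -r1; apply: poly_of_roots => //.
- by rewrite spanl0.
- apply/allP => x /allpairsP[[w c] [/= ws _ ->]].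
  have pw : p.[w] = 0 by apply/eqP; rewrite -rootE root_nprod // spanl0.
  rewrite rootE /r hornerD hornerN hornerZ horner_exp (qpoly_hornerD _ _ P) pw add0r.
  rewrite (qpoly_hornerZ _ _ P) -/b exprMn -[in iota c ^+ q](expn1 q) iota_expq.
  have -> : b ^+ q = b ^+ q.-1 * b by rewrite -exprSr prednK ?q_gt0.
  by rewrite mulrCA mulKf ?subrr // expf_neq0.
- by rewrite size_spanl; apply: size_qpoly.
Qed.

End QPolynomials.

(** * Lattice polynomials *)

Section Rows.
Variables (F : finFieldType) (r : nat).
Local Notation q := #|F|.
Local Notation polyrow := 'rV[{poly F}]_r.+1.
Implicit Types (b : polyrow) (d : nat).

Definition rscale (c : F) b : polyrow := c%:P *: b.

Lemma rscale0 b : rscale 0 b = 0. Proof. by rewrite /rscale polyC0 scale0r. Qed.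

Fixpoint row_basis d : seq polyrow :=
  if d is d'.+1 then [seq 'X^d' *: delta_mx 0 i | i <- enum 'I_r.+1] ++ row_basis d'
  else [::].

(** Presented as an F_q-span so that [nprod_qpoly] applies to its image in [C]; [mem_rows] recovers
    the description by degrees. *)
Definition rows d : seq polyrow := spanl rscale (row_basis d).

Lemma size_row_basis d : size (row_basis d) = (r.+1 * d)%N.
Proof.
by elim: d => [|d IH] /=; rewrite ?muln0 // size_cat size_map size_enum_ord IH mulnS.
Qed.

Lemma size_rows d : size (rows d) = (q ^ (r.+1 * d))%N.
Proof. by rewrite size_spanl size_row_basis. Qed.

Lemma mem_spanl_cat (I : Type) (e : seq I) (f : I -> polyrow) (c : I -> F) s w :
  w \in spanl rscale s ->
  w + \sum_(i <- e) rscale (c i) (f i) \in spanl rscale (map f e ++ s).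
Proof.
move=> ws; elim: e => [|i e IH]; first by rewrite big_nil addr0.
rewrite big_cons addrC -addrA [_ + w]addrC addrC; exact: spanl_cons.
Qed.

Lemma row_sum_delta b d :
  \sum_(i <- enum 'I_r.+1) rscale (b 0 i)`_d ('X^d *: delta_mx 0 i) =
  \row_j ((b 0 j)`_d *: 'X^d) :> polyrow.
Proof.
rewrite big_enum; apply/rowP => j; rewrite summxE (bigD1 j) //= big1 => [|i ij].
  by rewrite !mxE !eqxx /= mulr1 addr0 mul_polyC.
by rewrite !mxE eqxx eq_sym (negPf ij) /= !mulr0.
Qed.

Lemma mem_rows b d : (b \in rows d) = [forall i, size (b 0%R i) <= d]%N.
Proof.
apply/idP/forallP => [|]; last first.
  elim: d b => [|d IH] b hb.
    suff -> : b = 0 by exact: mem_head.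
    by apply/rowP => i; rewrite mxE; apply/eqP; rewrite -size_poly_leq0.
  pose b' := \row_j (b 0 j - (b 0 j)`_d *: 'X^d).
  have -> : b = b' + \sum_(i <- enum 'I_r.+1) rscale (b 0 i)`_d ('X^d *: delta_mx 0 i).
    by rewrite row_sum_delta; apply/rowP => j; rewrite !mxE subrK.
  apply: mem_spanl_cat; apply: IH => i; rewrite !mxE.
  apply/leq_sizeP => k; rewrite leq_eqVlt => /predU1P[<-|dk].
    by rewrite coefB coefZ coefXn eqxx mulr1 subrr.
  by rewrite coefB coefZ coefXn gtn_eqF // mulr0 subr0 nth_default // (leq_trans (hb i)).
rewrite /rows => h i; have : all (fun v : polyrow => size (v 0%R i) <= d)%N (row_basis d).
  elim: d {h} => //= d IH; rewrite all_cat; apply/andP; split.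
    apply/allP => _ /mapP[j _ ->]; rewrite !mxE eqxx /=.
    by case: (i == j); rewrite ?mulr0 ?mulr1 ?size_poly0 ?size_polyXn.
  by apply: sub_all IH => v /leqW.
elim: (row_basis d) b h => [|v s IH] b /=; first by rewrite inE => /eqP -> _; rewrite mxE size_poly0.
move=> /allpairsP[[w c] [/= ws _ ->]] /andP[vd /(IH _ ws) wd].
rewrite !mxE (leq_trans (size_polyD _ _)) // geq_max wd mul_polyC.
exact: leq_trans (size_scale_leq _ _) vd.
Qed.

(** By counting: the list is no longer than the set of matrices over [F], which embeds into it by
    reading rows as polynomials. *)
Lemma uniq_rows d : uniq (rows d).
Proof.
pose f (M : 'M[F]_(r.+1, d)) : polyrow := \row_i rVpoly (row i M).
have finj : injective f.
  move=> M M' /rowP e; apply/row_matrixP => i; apply: (can_inj rVpolyK).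
  by have := e i; rewrite !mxE.
apply: (@leq_size_uniq _ (map f (enum 'M[F]_(r.+1, d)))).
- by rewrite map_inj_uniq ?enum_uniq.
- move=> _ /mapP[M _ ->]; rewrite mem_rows; apply/forallP => i; rewrite mxE.
  exact: size_poly.
- by rewrite size_rows size_map -cardE card_mx.
Qed.

Lemma rows0 d : 0 \in rows d. Proof. exact: spanl0 rscale0. Qed.

Lemma rows_sub d d' : (d <= d')%N -> {subset rows d <= rows d'}.
Proof.
by move=> dd b; rewrite !mem_rows => /forallP h; apply/forallP => i; apply: leq_trans dd.
Qed.

Lemma rows_exhaust b : exists d, b \in rows d.
Proof.
exists (\max_i size (b 0%R i)); rewrite mem_rows; apply/forallP => i.
exact: (@leq_bigmax _ (fun i => size (b 0%R i))  i).
Qed.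

Lemma rowsB d b b' : b \in rows d -> b' \in rows d -> b - b' \in rows d.
Proof.
rewrite !mem_rows => /forallP h /forallP h'; apply/forallP => i.
by rewrite !mxE (leq_trans (size_polyD _ _)) // geq_max size_polyN h h'.
Qed.

Lemma rows_divX d b : b \in rows d.+1 ->
  exists2 a, a \in rows 1 & exists2 b', b' \in rows d & b = a + 'X *: b'.
Proof.
rewrite mem_rows => /forallP h.
exists (\row_i take_poly 1 (b 0 i)).
  by rewrite mem_rows; apply/forallP => i; rewrite mxE size_take_poly.
exists (\row_i drop_poly 1 (b 0 i)).
  by rewrite mem_rows; apply/forallP => i; rewrite mxE size_drop_poly leq_subLR add1n.
by apply/rowP => i; rewrite !mxE mulrC -['X]expr1 poly_take_drop.
Qed.

(** Used to see that rows of constants represent distinct classes modulo ['X], hence distinct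
    theta-division points modulo the lattice. *)
Lemma rows1_mulX b b' : b \in rows 1 -> b = 'X *: b' -> b = 0.
Proof.
rewrite mem_rows => /forallP h e; apply/rowP => i; have := h i.
rewrite e !mxE; have [->|b0] := eqVneq (b' 0 i) 0; first by rewrite mulr0.
by rewrite mulrC size_mulX // ltnS leqn0 size_poly_eq0 (negPf b0).
Qed.

Lemma prod_rows_split (T : comPzRingType) d d' (f : polyrow -> T) : (d <= d')%N ->
  \prod_(b <- rows d' | b != 0) f b =
  (\prod_(b <- rows d | b != 0) f b) * \prod_(b <- rows d' | b \notin rows d) f b.
Proof.
move=> dd; rewrite (bigID (mem (rows d))) /=; congr (_ * _).
  rewrite -big_filter -[in RHS]big_filter; apply: perm_big; apply: uniq_perm.
  - exact: filter_uniq (uniq_rows _).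
  - exact: filter_uniq (uniq_rows _).
  move=> b; rewrite !mem_filter; case: eqP => //= _.
  by case: (boolP (b \in _)) => //= bd; rewrite (rows_sub dd).
apply: eq_bigl => b; case: (boolP (b \in _)); rewrite ?andbF // andbT.
by apply: contraNneq => ->; rewrite rows0.
Qed.

End Rows.

(** * The polynomials E_d of a lattice and their division polynomials *)

Section LatticePolynomials.
Variables (F : finFieldType) (C : fieldType) (R : realType).
Variables (iota : {rmorphism F -> C}) (theta : C) (absC : C -> R).
Hypothesis HC : is_Cinfty iota theta absC.
Variable r : nat.
Local Notation q := #|F|.
Local Notation A := (Aemb iota theta).
Local Notation N := r.+1.
Local Notation iscale := (fun (c : F) (x : C) => iota c * x).
Implicit Types (z : 'cV[C]_N) (b : 'rV[{poly F}]_N).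

Definition dot z b : C := \sum_i A (b 0 i) * z i 0.

Lemma dotD z : {morph dot z : b b' / b + b'}.
Proof. by move=> b b'; rewrite -big_split; apply: eq_bigr => i _; rewrite mxE rmorphD mulrDl. Qed.

Lemma dotZ z a b : dot z (a *: b) = A a * dot z b.
Proof. by rewrite mulr_sumr; apply: eq_bigr => i _; rewrite mxE rmorphM mulrA. Qed.

Lemma dot0 z : dot z 0 = 0.
Proof. by rewrite -(scale0r (0 : 'rV_N)) dotZ rmorph0 mul0r. Qed.

Lemma dotB z b b' : dot z (b - b') = dot z b - dot z b'.
Proof. by rewrite -scaleN1r dotD dotZ rmorphN1 mulN1r. Qed.

Lemma dot_rscale z c b : dot z (rscale c b) = iota c * dot z b.
Proof. by rewrite dotZ AembC. Qed.

Lemma dotZX z b : dot z ('X *: b) = theta * dot z b.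
Proof. by rewrite dotZ AembX. Qed.

Lemma inLatticeP z x : inLattice iota theta z x <-> exists b, x = dot z b.
Proof.
split=> [[a ->]|[b ->]]; last by exists (b 0).
by exists (\row_i a i); apply: eq_bigr => i _; rewrite mxE.
Qed.

Definition lat z d : seq C := map (dot z) (rows F r d).
Definition latpoly z d : {poly C} := nprod (lat z d).

Lemma lat0 z d : 0 \in lat z d.
Proof. by apply/mapP; exists 0; rewrite ?rows0 ?dot0. Qed.

Lemma lat_spanl z d : lat z d = spanl iscale (map (dot z) (row_basis F r d)).
Proof. exact: map_spanl (dot0 z) (dotD z) (dot_rscale z). Qed.

Lemma size_lat z d : size (lat z d) = (q ^ (N * d))%N.
Proof. by rewrite size_map size_rows. Qed.

(** The function [e] is a parameter because it will be both the exponential and its approximations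
    [latpoly z d]. *)
Definition divpts (e : C -> C) z : seq C := [seq e (dot z b / theta) | b <- rows F r 1].
Definition divpoly e z : {poly C} := theta *: nprod (divpts e z).

Lemma size_divpts e z : size (divpts e z) = (q ^ N)%N.
Proof. by rewrite size_map size_rows muln1. Qed.

Lemma divpts0 e z : e 0 = 0 -> 0 \in divpts e z.
Proof. by move=> e0; apply/mapP; exists 0; rewrite ?rows0 // dot0 mul0r e0. Qed.

(** If two values agree, the difference of the two division points is in the lattice; so the
    difference of the two rows of constants is a multiple of ['X], hence zero. *)
Lemma uniq_divpts e z : (forall b, dot z b = 0 -> b = 0) ->
  {morph e : x y / x - y} -> (forall x, e x = 0 -> inLattice iota theta z x) ->
  uniq (divpts e z).
Proof.
move=> zinj eB e0; rewrite map_inj_in_uniq ?uniq_rows // => b b' hb hb' /eqP.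
rewrite -subr_eq0 -eB -mulrBl -dotB => /eqP/e0/inLatticeP[b'' eb].
apply/eqP; rewrite -subr_eq0; apply/eqP/(@rows1_mulX _ _ _ b''); first exact: rowsB.
apply/eqP; rewrite -subr_eq0; apply/eqP/zinj; rewrite dotB dotZX -eb.
by rewrite mulrC divfK ?subrr // (theta_neq0 HC).
Qed.

Section Fixed.
Variable z : 'cV[C]_N.
Hypothesis zinj : forall b, dot z b = 0 -> b = 0.

Lemma dot_inj : injective (dot z).
Proof.
move=> b b' /eqP; rewrite -subr_eq0 -dotB => /eqP/zinj/eqP.
by rewrite subr_eq0 => /eqP.
Qed.

Lemma uniq_lat d : uniq (lat z d).
Proof. by rewrite map_inj_uniq ?uniq_rows //; apply: dot_inj. Qed.

Lemma latpoly_qpoly d : is_qpoly F (N * d) (latpoly z d).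
Proof.
rewrite /latpoly lat_spanl -(size_row_basis F r) -(size_map (dot z)).
by apply: nprod_qpoly; rewrite -lat_spanl uniq_lat.
Qed.

Lemma root_latpoly d x : root (latpoly z d) x = (x \in lat z d).
Proof. by rewrite root_nprod // lat0. Qed.

(** The division values are the F_q-span of the images of [row_basis F r 1], since [e] is
    F_q-linear. *)
Lemma divpoly_qpoly e : {morph e : x y / x + y} -> (forall c x, e (iota c * x) = iota c * e x) ->
  uniq (divpts e z) -> is_qpoly F N (divpoly e z).
Proof.
move=> eD eZ.
have e0 : e 0 = 0 by have := eZ 0 0; rewrite rmorph0 !mul0r.
rewrite /divpoly; have -> : divpts e z = spanl iscale [seq e (dot z b / theta) | b <- row_basis F r 1].
  apply: map_spanl => [|b b'|c b]; first by rewrite dot0 mul0r.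
    by rewrite dotD mulrDl eD.
  by rewrite dot_rscale -mulrA eZ.
move=> u; have [c] := nprod_qpoly u; rewrite size_map size_row_basis muln1 => pE.
exists (fun i => theta * c i).
by rewrite pE scaler_sumr; apply: eq_bigr => i _; rewrite scalerA.
Qed.

Local Notation phi d := (divpoly (horner (latpoly z d)) z).

Lemma uniq_divpts_lat d : uniq (divpts (horner (latpoly z d)) z).
Proof.
apply: uniq_divpts => // [x y|x].
  exact: (qpoly_hornerB iota _ _ (latpoly_qpoly d)).
by move/eqP; rewrite -rootE root_latpoly => /mapP[b _ ->]; apply/inLatticeP; exists b.
Qed.

Lemma divpoly_lat_qpoly d : is_qpoly F N (phi d).
Proof.
apply: divpoly_qpoly; last exact: uniq_divpts_lat.
  by move=> x y; apply: (qpoly_hornerD iota _ _ (latpoly_qpoly d)).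
by move=> c x; apply: (qpoly_hornerZ iota _ _ (latpoly_qpoly d)).
Qed.

(* Both sides vanish on the division of [lat z d.+1] by theta, have the degree given
   by its cardinal, and linear coefficient theta. *)
Lemma latpoly_mul_theta d x : (latpoly z d.+1).[theta * x] = (phi d).[(latpoly z d).[x]].
Proof.
have t0 := theta_neq0 HC.
pose rs := [seq y / theta | y <- lat z d.+1].
have urs : uniq rs by rewrite map_inj_uniq ?uniq_lat //; apply: mulIf; rewrite invr_eq0.
have rs0 : 0 \in rs by apply/mapP; exists 0; rewrite ?lat0 ?mul0r.
have srs : size rs = (q ^ (N * d.+1))%N by rewrite size_map size_lat.
have E0 : (latpoly z d).[0] = 0 by apply/eqP; rewrite -rootE root_latpoly lat0.
suff e : latpoly z d.+1 \Po (theta *: 'X) = phi d \Po latpoly z d.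
  by have := congr1 (horner^~ x) e; rewrite !horner_comp hornerZ hornerX.
rewrite (@poly_of_roots _ (_ \Po (_ *: 'X)) rs) //.
- rewrite (@poly_of_roots _ (phi d \Po _) rs) //.
  + congr (_ *: _); rewrite !deriv_comp !hornerM !horner_comp E0 deriv_nprod mulr1.
    rewrite !derivZ derivX !hornerZ hornerX mulr0 !deriv_nprod mul1r.
    by rewrite -polyC1 hornerC.
  + apply/allP => _ /mapP[_ /mapP[b bd ->] ->]; rewrite rootE horner_comp.
    (* Writing [b = a + 'X *: b'], the part [b'] contributes a root of [latpoly z d], which leaves
       the value at the division point of [a]. *)
    have [a ha [b' hb' ->]] := rows_divX bd.
    rewrite dotD dotZX mulrDl (qpoly_hornerD iota _ _ (latpoly_qpoly d)).
    rewrite [theta * _]mulrC mulfK //.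
    have -> : (latpoly z d).[dot z b'] = 0.
      by apply/eqP; rewrite -rootE root_latpoly map_f.
    rewrite addr0 hornerZ mulf_eq0 -rootE root_nprod; last exact: divpts0.
    by apply/orP; right; apply/mapP; exists a.
  + apply: leq_trans (size_comp_poly_leq _ _) _; rewrite ltnS srs mulnS expnD.
    apply: leq_mul; rewrite -subn1 leq_subLR add1n.
      exact: size_qpoly (divpoly_lat_qpoly d).
    exact: size_qpoly (latpoly_qpoly d).
- apply/allP => _ /mapP[y hy ->]; rewrite rootE horner_comp hornerZ hornerX.
  by rewrite mulrC divfK // -rootE root_latpoly.
- apply: leq_trans (size_comp_poly_leq _ _) _; rewrite ltnS srs.
  rewrite size_scale // size_polyX muln1 -subn1 leq_subLR add1n.
  exact: size_qpoly (latpoly_qpoly d.+1).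
Qed.

End Fixed.
End LatticePolynomials.

(** * Gauss norms *)

Section GaussNorms.
Variables (F : finFieldType) (C : fieldType) (R : realType).
Variables (iota : {rmorphism F -> C}) (theta : C) (absC : C -> R).
Hypothesis HC : is_Cinfty iota theta absC.
Local Notation q := #|F|.
Local Notation A := (Aemb iota theta).
Local Notation cvg := (cvgC absC).
Local Notation abs_ge0 := (abs_ge0 HC).
Local Notation absM := (absM HC).

Lemma halfr_gt0 (x : R) : 0 < x -> 0 < x / 2.
Proof. by move=> x0; rewrite divr_gt0. Qed.

Lemma halfr_lt (x : R) : 0 < x -> x / 2 < x.
Proof. by move=> x0; rewrite ltr_pdivrMr // mulr_natr mulr2n ltrDl. Qed.

(** The bound does not grow with the number of factors: in [(p - 1) + u p] both terms are at most
    [eta], as [p] has absolute value at most 1. *)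
Lemma abs_prod_sub1 (I : Type) (s : seq I) (P : pred I) (u : I -> C) eta :
  0 <= eta <= 1 -> (forall i, P i -> absC (u i) <= eta) ->
  absC (\prod_(i <- s | P i) (1 + u i) - 1) <= eta.
Proof.
move=> /andP[eta0 eta1] h; elim: s => [|i s IH].
  by rewrite big_nil subrr (abs0 HC).
rewrite big_cons; case: ifP => // Pi; set p := \prod_(_ <- _ | _) _ in IH *.
have -> : (1 + u i) * p - 1 = (p - 1) + u i * p by ring.
apply: (abs_addP HC) => //; rewrite absM -[eta]mulr1.
apply: ler_pM; rewrite ?abs_ge0 ?h // -(subrK 1 p).
apply: (abs_addP HC); rewrite ?(abs1 HC) //; exact: le_trans IH eta1.
Qed.

(** An upper bound for the Gauss norm of radius [rho], which controls coefficients and values on the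
    disc of that radius together. *)
Definition gauss_le (rho M : R) (p : {poly C}) := forall k, absC p`_k * rho ^+ k <= M.

Section FixedRadius.
Variable rho : R.
Hypothesis rho0 : 0 <= rho.

Lemma gauss_leD M p1 p2 : gauss_le rho M p1 -> gauss_le rho M p2 -> gauss_le rho M (p1 + p2).
Proof.
move=> h1 h2 k; rewrite coefD; have /orP[h|h] := le_total (absC p1`_k) (absC p2`_k).
  apply: le_trans (h2 k); rewrite ler_wpM2r ?exprn_ge0 //; exact: (abs_addP HC).
apply: le_trans (h1 k); rewrite ler_wpM2r ?exprn_ge0 //; exact: (abs_addP HC).
Qed.

Lemma gauss_leW M M' p : M <= M' -> gauss_le rho M p -> gauss_le rho M' p.
Proof. by move=> MM h k; apply: le_trans (h k) MM. Qed.

Lemma gauss_leN M p : gauss_le rho M p -> gauss_le rho M (- p).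
Proof. by move=> h k; rewrite coefN (absN HC). Qed.

Lemma gauss_le_sum M (I : Type) (s : seq I) (f : I -> C) k : 0 <= M ->
  (forall i, absC (f i) * rho ^+ k <= M) -> absC (\sum_(i <- s) f i) * rho ^+ k <= M.
Proof.
move=> M0 h; have [rk0|rk0] := eqVneq (rho ^+ k) 0; first by rewrite rk0 mulr0.
have rk : 0 < rho ^+ k by rewrite lt_def rk0 exprn_ge0.
rewrite -ler_pdivlMr //; apply: (abs_sumP HC); first exact: divr_ge0 (ltW rk).
by move=> i _; rewrite ler_pdivlMr.
Qed.

Lemma gauss_leM M1 M2 p1 p2 : 0 <= M1 -> 0 <= M2 ->
  gauss_le rho M1 p1 -> gauss_le rho M2 p2 -> gauss_le rho (M1 * M2) (p1 * p2).
Proof.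
move=> M10 M20 h1 h2 k; rewrite coefM; apply: gauss_le_sum; first exact: mulr_ge0.
move=> i; rewrite absM -[X in rho ^+ X](subnKC (leq_ord i)) exprD mulrACA.
by apply: ler_pM => //; rewrite mulr_ge0 ?exprn_ge0 ?abs_ge0.
Qed.

Lemma gauss_leZX c : gauss_le rho (absC c * rho) (c *: 'X).
Proof.
move=> k; rewrite coefZ coefX; case: eqP => [->|_]; first by rewrite mulr1.
by rewrite mulr0 (abs0 HC) mul0r mulr_ge0 ?abs_ge0.
Qed.

Lemma gauss_le1 : gauss_le rho 1 1.
Proof.
move=> k; rewrite coef1; case: eqP => [->|_]; first by rewrite (abs1 HC) mulr1.
by rewrite (abs0 HC) mul0r.
Qed.

Lemma gauss_le_prod_sub1 (I : Type) (s : seq I) (P : pred I) (u : I -> C) eta :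
  0 <= eta <= 1 -> (forall i, P i -> absC (u i) * rho <= eta) ->
  gauss_le rho eta (\prod_(i <- s | P i) (1 - u i *: 'X) - 1).
Proof.
move=> /andP[eta0 eta1] h; elim: s => [|i s IH].
  by rewrite big_nil subrr => k; rewrite coef0 (abs0 HC) mul0r.
rewrite big_cons; case: ifP => // Pi; set p := \prod_(_ <- _ | _) _ in IH *.
have -> : (1 - u i *: 'X) * p - 1 = (p - 1) - (u i *: 'X) * p by ring.
apply: gauss_leD => //; apply: gauss_leN; rewrite -[eta]mulr1.
apply: gauss_leM => //; first exact: gauss_leW (h i Pi) (gauss_leZX _).
rewrite -(subrK 1 p); apply: gauss_leD (gauss_le1); exact: gauss_leW eta1 IH.
Qed.

Lemma gauss_le_exists (p : {poly C}) : exists2 M, 0 < M & gauss_le rho M p.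
Proof.
exists (1 + \sum_(k < size p) absC p`_k * rho ^+ k).
  by rewrite ltr_wpDr // sumr_ge0 // => k _; rewrite mulr_ge0 ?abs_ge0 ?exprn_ge0.
move=> k; have s0 (P : pred 'I_(size p)) : 0 <= \sum_(k < size p | P k) absC p`_k * rho ^+ k.
  by rewrite sumr_ge0 // => i _; rewrite mulr_ge0 ?abs_ge0 ?exprn_ge0.
have [kp|kp] := ltnP k (size p); last first.
  by rewrite nth_default // (abs0 HC) mul0r addr_ge0 // s0.
by rewrite (bigD1 (Ordinal kp)) //= addrCA lerDl addr_ge0 // s0.
Qed.

End FixedRadius.

(** Radius 1 gives the limits of the coefficients. Radius [absC x + 1] brings the partial sums of
    the limit series close to [(P d).[x]], uniformly in their length, which gives both convergence
    and the value. *)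
Lemma qpoly_limit (n : nat -> nat) (P : nat -> {poly C}) :
  (forall d, is_qpoly F (n d) (P d)) ->
  (forall rho eps, 0 < rho -> 0 < eps ->
    exists D, forall d d', (D <= d)%N -> (d <= d')%N -> gauss_le rho eps (P d' - P d)) ->
  exists (ec : nat -> C) (e : C -> C),
    [/\ forall i, cvg (fun d => (P d)`_(q ^ i)) (ec i),
        forall x, seriesC absC (fun i => ec i * x ^+ (q ^ i)) (e x) &
        forall x, cvg (fun d => (P d).[x]) (e x)].
Proof.
move=> PQ PC.
have cE i : exists l, cvg (fun d => (P d)`_(q ^ i)) l.
  apply: (C_complete HC) => e e0.
  have [D h] := PC 1 (e / 2) ltr01 (halfr_gt0 e0).
  exists D => d d' Dd Dd'; apply: (@le_lt_trans _ _ (e / 2)); last exact: halfr_lt.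
  have /orP[dd|dd] := leq_total d d'.
    by have := h d d' Dd dd (q ^ i)%N; rewrite expr1n mulr1 coefB (abs_distC HC).
  by have := h d' d Dd' dd (q ^ i)%N; rewrite expr1n mulr1 coefB.
pose ec i := epsilon (inhabits 0) (cvg (fun d => (P d)`_(q ^ i))).
have ecP i : cvg (fun d => (P d)`_(q ^ i)) (ec i) by exact: epsilon_spec.
pose S x M := \sum_(i < M) ec i * x ^+ (q ^ i).
have PE d x M : (n d < M)%N -> (P d).[x] = \sum_(i < M) (P d)`_(q ^ i) * x ^+ (q ^ i).
  move=> dM; rewrite {1}(qpoly_coef (PQ d)) horner_sum.
  rewrite (big_ord_widen _ (fun i => ((P d)`_(q ^ i) *: 'X^(q ^ i)).[x]) dM).
  rewrite big_mkcond; apply: eq_bigr => i _; case: ltnP => [_|ni].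
    by rewrite hornerZ hornerXn.
  rewrite nth_default ?mul0r //; apply: leq_trans (size_qpoly (PQ d)) _.
  by rewrite ltn_exp2l ?q_gt1.
have key x eps : 0 < eps -> exists D, forall d, (D <= d)%N ->
    forall M, (n d < M)%N -> absC (S x M - (P d).[x]) <= eps.
  move=> eps0; have rho0 : 0 < absC x + 1 by rewrite ltr_wpDl ?abs_ge0.
  have [D h] := PC _ _ rho0 eps0; exists D => d Dd M dM.
  rewrite (PE _ _ _ dM) -sumrB; apply: (abs_sumP HC); first exact: ltW.
  move=> i _; rewrite -mulrBl absM (absX HC).
  apply: (@le_trans _ _ (absC (ec i - (P d)`_(q ^ i)) * (absC x + 1) ^+ (q ^ i))).
    by rewrite ler_wpM2l ?abs_ge0 // lerXn2r ?nnegrE ?abs_ge0 ?(ltW rho0) // lerDl.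
  rewrite -ler_pdivlMr ?exprn_gt0 //; apply: (cvg_dist_le HC (N0 := d) (ecP i)) => d' dd'.
  by rewrite ler_pdivlMr ?exprn_gt0 // -coefB h.
have sE x : exists l, cvg (S x) l.
  apply: (C_complete HC) => e e0.
  have [D /(_ D (leqnn D)) h] := key x (e / 2) (halfr_gt0 e0).
  exists (n D).+1 => M M' hM hM'; apply: (@le_lt_trans _ _ (e / 2)); last exact: halfr_lt.
  by apply: (abs_distP HC (y := (P D).[x])); rewrite 1?(abs_distC HC _ (S x M')) h.
pose e x := epsilon (inhabits 0) (cvg (S x)).
have eP x : cvg (S x) (e x) by exact: epsilon_spec.
exists ec, e; split=> // x eps eps0.
have [D h] := key x (eps / 2) (halfr_gt0 eps0).
exists D => d Dd; apply: (@le_lt_trans _ _ (eps / 2)); last exact: halfr_lt.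
by rewrite (abs_distC HC); apply: (cvg_dist_le HC (eP x)) (h _ Dd).
Qed.

End GaussNorms.

(** * Existence of the Drinfeld module *)

Section Existence.
Variables (F : finFieldType) (C : fieldType) (R : realType).
Variables (iota : {rmorphism F -> C}) (theta : C) (absC : C -> R).
Hypothesis HC : is_Cinfty iota theta absC.
Variable r : nat.
Local Notation q := #|F|.
Local Notation A := (Aemb iota theta).
Local Notation N := r.+1.
Local Notation cvg := (cvgC absC).
Local Notation abs_ge0 := (abs_ge0 HC).
Local Notation absM := (absM HC).
Local Notation dot := (dot iota theta).
Local Notation latpoly := (latpoly iota theta).
Local Notation divpts := (divpts iota theta).
Local Notation divpoly := (divpoly iota theta).
Implicit Types (z : 'cV[C]_N) (b : 'rV[{poly F}]_N).

(** A quantitative form of independence over A, deduced from [Omega] in [Omega_indep]. It makes no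
    normalization of the last entry and survives small perturbations with the same [c], by
    [indep_near]. *)
Definition indep (c : R) z := 0 < c /\ forall b i, c * absC (A (b 0 i)) <= absC (dot z b).

Section Fixed.
Variables (c : R) (z : 'cV[C]_N).
Hypothesis zc : indep c z.

Lemma indep_inj b : dot z b = 0 -> b = 0.
Proof.
move=> e; apply/rowP => i; rewrite mxE; apply/eqP; rewrite -(Aemb_eq0 HC).
apply/negPn/negP => /(abs_gt0 HC) h; have [c0 /(_ b i)] := zc.
by rewrite e (abs0 HC) leNgt mulr_gt0.
Qed.

Lemma dot_neq0 b : b != 0 -> dot z b != 0.
Proof. by apply: contraNneq => /indep_inj ->. Qed.

Lemma indep_far b d : b \notin rows F r d -> c * q%:R ^+ d <= absC (dot z b).
Proof.
rewrite mem_rows negb_forall => /existsP[i]; rewrite -ltnNge => di.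
have [c0 /(_ b i)] := zc; apply: le_trans; rewrite ler_wpM2l ?(ltW c0) //.
have b0 : b 0 i != 0 by apply: contraTneq di => ->; rewrite size_poly0.
rewrite (abs_Aemb HC) // ler_weXn2l ?ler1n ?(ltnW (q_gt1 F)) //.
by rewrite -ltnS prednK // (leq_ltn_trans _ di).
Qed.

Lemma radius_ge0 d : 0 < c * q%:R ^+ d.
Proof. by case: zc => c0 _; rewrite mulr_gt0 ?exprn_gt0 ?q_gt0R. Qed.

Lemma radius_large (M : R) : exists D, forall d, (D <= d)%N -> M < c * q%:R ^+ d.
Proof.
have [c0 _] := zc; have M0 : 0 < `|M| + 1 by rewrite ltr_wpDl.
have [D h] := geom_small (q_ge2 F R) (divr_gt0 c0 M0).
exists D => d Dd; apply: (@le_lt_trans _ _ `|M|); first exact: ler_norm.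
apply: (@lt_le_trans _ _ (`|M| + 1)); first by rewrite ltrDl.
apply: (@le_trans _ _ (c * q%:R ^+ D)).
  by move: h; rewrite ltr_pdivlMr // mulrC ltr_pdivrMr ?exprn_gt0 ?q_gt0R // => /ltW.
by rewrite ler_wpM2l ?(ltW c0) // ler_weXn2l // ler1n ltnW ?q_gt1.
Qed.

Lemma latpolyE d :
  latpoly z d = 'X * \prod_(b <- rows F r d | b != 0) (1 - (dot z b)^-1 *: 'X).
Proof.
rewrite /latpoly /nprod big_map; congr (_ * _); apply: eq_bigl => b.
by apply/idP/idP => [|/dot_neq0//]; apply: contraNneq => ->; rewrite dot0.
Qed.

Lemma latpoly_factor d d' : (d <= d')%N ->
  latpoly z d' = latpoly z d *
    \prod_(b <- rows F r d' | b \notin rows F r d) (1 - (dot z b)^-1 *: 'X).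
Proof.
by move=> dd; rewrite !latpolyE -mulrA -prod_rows_split.
Qed.

(** The factors added after stage d have roots of absolute value at least [c * q^d], so their
    product is within [rho / (c * q^d)] of 1 in Gauss norm. *)
Lemma latpoly_gauss rho eps : 0 < rho -> 0 < eps -> exists D, forall d d',
  (D <= d)%N -> (d <= d')%N -> gauss_le absC rho eps (latpoly z d' - latpoly z d).
Proof.
move=> rho0 eps0; have [D1 h1] := radius_large rho.
have step d d' M : (D1 <= d)%N -> (d <= d')%N -> 0 < M -> gauss_le absC rho M (latpoly z d) ->
    gauss_le absC rho (M * (rho / (c * q%:R ^+ d))) (latpoly z d' - latpoly z d).
  move=> Dd dd M0 h; rewrite (latpoly_factor dd) -{2}[latpoly z d]mulr1 -mulrBr.
  have eta : 0 <= rho / (c * q%:R ^+ d) <= 1.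
    rewrite divr_ge0 ?(ltW rho0) ?(ltW (radius_ge0 _)) //=.
    by rewrite ler_pdivrMr ?radius_ge0 // mul1r ltW ?h1.
  apply: (gauss_leM HC) => //; [exact: ltW|exact: ltW|by case/andP: eta|].
  apply: (gauss_le_prod_sub1 HC) => //; first exact: ltW.
  move=> b bd; rewrite (absV HC) mulrC ler_wpM2l ?(ltW rho0) //.
  rewrite lef_pV2 ?posrE ?radius_ge0 ?indep_far //.
  exact: lt_le_trans (radius_ge0 d) (indep_far bd).
have [M M0 hM] := gauss_le_exists HC (ltW rho0) (latpoly z D1).
(* A first use of [step], from [D1], bounds all later polynomials by the same [M]; the second use
   then makes their differences small. *)
have bnd d : (D1 <= d)%N -> gauss_le absC rho M (latpoly z d).
  move=> Dd; rewrite -(subrKC (latpoly z D1) (latpoly z d)).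
  apply: (gauss_leD HC) => //; first exact: ltW.
  apply: gauss_leW (step _ _ _ (leqnn _) Dd M0 hM).
  rewrite ger_pMr // ler_pdivrMr ?radius_ge0 // mul1r ltW ?h1 //.
have [D2 h2] := radius_large (M * rho / eps).
exists (maxn D1 D2) => d d'; rewrite geq_max => /andP[hd1 hd2] dd.
apply: gauss_leW (step _ _ _ hd1 dd M0 (bnd _ hd1)).
rewrite mulrA ler_pdivrMr ?radius_ge0 // [eps * _]mulrC -ler_pdivrMr //.
exact/ltW/h2.
Qed.

Lemma latpoly_eval d d' x : (d <= d')%N -> absC x <= c * q%:R ^+ d ->
  absC ((latpoly z d').[x] - (latpoly z d).[x])
    <= absC (latpoly z d).[x] * (absC x / (c * q%:R ^+ d)).
Proof.
move=> dd hx; rewrite (latpoly_factor dd) hornerM -{2}[(latpoly z d).[x]]mulr1 -mulrBr.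
rewrite absM ler_wpM2l ?abs_ge0 // horner_prod.
under eq_bigr => b _ do rewrite hornerD hornerN hornerZ hornerX -polyC1 hornerC -mulNr.
apply: (abs_prod_sub1 HC) => [|b bd].
  by rewrite divr_ge0 ?abs_ge0 ?(ltW (radius_ge0 _)) //= ler_pdivrMr ?radius_ge0 // mul1r.
rewrite absM (absN HC) (absV HC) mulrC ler_wpM2l ?abs_ge0 //.
rewrite lef_pV2 ?posrE ?radius_ge0 ?indep_far //.
exact: lt_le_trans (radius_ge0 d) (indep_far bd).
Qed.

Lemma latpoly_lattice x : inLattice iota theta z x ->
  exists D, forall d, (D <= d)%N -> (latpoly z d).[x] = 0.
Proof.
move=> /inLatticeP[b ->]; have [D bD] := rows_exhaust b; exists D => d Dd.
by apply/eqP; rewrite -rootE root_latpoly map_f // (rows_sub Dd).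
Qed.

(** By [latpoly_eval] the relative change after stage D is less than 1 when [absC x < c * q^D]. The
    constant absolute value keeps the limit away from 0. *)
Lemma latpoly_nonlattice x : ~ inLattice iota theta z x ->
  exists D, forall d, (D <= d)%N -> absC (latpoly z d).[x] = absC (latpoly z D).[x] /\
    (latpoly z d).[x] != 0.
Proof.
move=> xL; have n0 d : (latpoly z d).[x] != 0.
  rewrite -rootE root_latpoly; apply/negP => /mapP[b _ e]; apply: xL.
  by apply/inLatticeP; exists b.
have [D h] := radius_large (absC x); exists D => d Dd; split=> //.
apply: (abs_dist_eq HC); apply: le_lt_trans (latpoly_eval Dd (ltW (h _ (leqnn D)))) _.
by rewrite gtr_pMr ?(abs_gt0 HC) // ltr_pdivrMr ?radius_ge0 // mul1r h.
Qed.

Lemma divpts_eq0 (e : C -> C) b : e 0 = 0 -> uniq (divpts e z) -> b \in rows F r 1 ->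
  (e (dot z b / theta) == 0) = (b == 0).
Proof.
move=> e0 u b1; apply/idP/idP => [/eqP eb|/eqP ->]; last by rewrite dot0 mul0r e0.
apply/eqP; apply: (uniq_map_inj u) => //; first exact: rows0.
by rewrite dot0 mul0r e0.
Qed.

Lemma divpolyE e x : e 0 = 0 -> uniq (divpts e z) ->
  (divpoly e z).[x] =
    theta * (x * \prod_(b <- rows F r 1 | b != 0) (1 - x / e (dot z b / theta))).
Proof.
move=> e0 u; rewrite hornerZ horner_nprod /divpts big_map.
congr (_ * (_ * _)); rewrite big_seq_cond [RHS]big_seq_cond; apply: eq_bigl => b.
by case: (boolP (b \in _)) => //= b1; rewrite divpts_eq0.
Qed.

Lemma lead_divpoly e : e 0 = 0 -> uniq (divpts e z) ->
  (divpoly e z)`_(q ^ N) =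
    theta * \prod_(b <- rows F r 1 | b != 0) (- (e (dot z b / theta))^-1).
Proof.
move=> e0 u; rewrite coefZ -(size_divpts iota theta e z) lead_nprod ?divpts0 // big_map.
congr (_ * _); rewrite big_seq_cond [RHS]big_seq_cond; apply: eq_bigl => b.
by case: (boolP (b \in _)) => //= b1; rewrite divpts_eq0.
Qed.

Lemma divpoly_coef1 e : (divpoly e z)`_1 = theta.
Proof.
by rewrite coefZ -[1%N]add0n -[_`_(0 + 1)]mulr1n -coef_deriv -horner_coef0 deriv_nprod mulr1.
Qed.

Lemma latpoly_coef1 d : (latpoly z d)`_1 = 1.
Proof. by rewrite -[1%N]add0n -[_`_(0 + 1)]mulr1n -coef_deriv -horner_coef0 deriv_nprod. Qed.

(** The exponential is the limit of the [latpoly z d], and its functional equation is the limit of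
    [latpoly_mul_theta]; the [g i] are read off from [divpoly e z]. *)
Lemma exists_Drinfeld : exists (e : C -> C) (ec g : nat -> C),
  [/\ ec 0%N = 1, forall x, seriesC absC (fun i => ec i * x ^+ (q ^ i)) (e x),
      forall x, e x = 0 <-> inLattice iota theta z x,
      forall x, e (theta * x) = theta * e x + \sum_(1 <= i < r.+2) g i * (e x) ^+ (q ^ i) &
      forall x, cvg (fun d => (latpoly z d).[x]) (e x)].
Proof.
have PQ := latpoly_qpoly indep_inj.
have [ec [e [ecP eS eP]]] := qpoly_limit HC PQ latpoly_gauss.
have e0P x : e x = 0 <-> inLattice iota theta z x.
  split=> [ex0|/latpoly_lattice[D h]]; last first.
    apply: (cvg_uniq HC (eP x)); apply: (cvg_eventually (N0 := D)) (cvg_cst HC 0) => d Dd.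
    by rewrite h.
  have [//|xL] := classic (inLattice iota theta z x).
  have [D h] := latpoly_nonlattice xL; have [_ n0] := h _ (leqnn D).
  have := eP x; rewrite ex0 => /(_ _ (abs_gt0 HC n0))[D' h'].
  have := h' _ (leq_maxr D D'); rewrite subr0; have [-> _] := h _ (leq_maxl D D').
  by rewrite ltxx.
have eD : {morph e : x y / x + y}.
  move=> x y; apply: (cvg_uniq HC (eP _)).
  apply: cvg_ext (cvgD HC (eP x) (eP y)) => d.
  by rewrite (qpoly_hornerD iota _ _ (PQ d)).
have eZ a x : e (iota a * x) = iota a * e x.
  apply: (cvg_uniq HC (eP _)).
  apply: cvg_ext (cvgM HC (cvg_cst HC (iota a)) (eP x)) => d.
  by rewrite (qpoly_hornerZ iota _ _ (PQ d)).
have eB : {morph e : x y / x - y}.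
  by move=> x y; apply/eqP; rewrite eq_sym subr_eq -eD subrK.
have e0 : e 0 = 0 by rewrite -[in LHS](subrr 0) eB subrr.
have u : uniq (divpts e z).
  by apply: (uniq_divpts HC indep_inj eB) => x /e0P.
have phiQ := divpoly_qpoly eD eZ u.
exists e, ec, (fun i => (divpoly e z)`_(q ^ i)); split=> //.
  apply: (cvg_uniq HC (ecP 0%N)); apply: cvg_ext (cvg_cst HC 1) => d.
  by rewrite expn0 latpoly_coef1.
move=> x; have -> : theta * e x + \sum_(1 <= i < r.+2) (divpoly e z)`_(q ^ i) * e x ^+ (q ^ i)
    = (divpoly e z).[e x].
  rewrite [in RHS](qpoly_coef phiQ) horner_sum.
  rewrite -(big_mkord predT (fun i => ((divpoly e z)`_(q ^ i) *: 'X^(q ^ i)).[e x])) /=.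
  rewrite [RHS]big_ltn // expn0 divpoly_coef1 hornerZ hornerXn expr1; congr (_ + _).
  by apply: eq_bigr => i _; rewrite hornerZ hornerXn.
apply: (cvg_uniq HC (cvg_comp (s := succn) (fun n => leqnSn n) (eP _))).
apply: (@cvg_ext _ _ _ (fun d => (divpoly (horner (latpoly z d)) z).[(latpoly z d).[x]])).
  by move=> d; rewrite /= -(latpoly_mul_theta HC indep_inj).
rewrite divpolyE //.
apply: (@cvg_ext _ _ _ (fun d => theta * ((latpoly z d).[x] *
  \prod_(b <- rows F r 1 | b != 0) (1 - (latpoly z d).[x] / (latpoly z d).[dot z b / theta])))).
  move=> d; rewrite divpolyE ?(uniq_divpts_lat HC indep_inj) //.
  exact: qpoly_horner0 iota _ _ (PQ d).
apply: (cvgM HC (cvg_cst HC _)); apply: (cvgM HC (eP x)).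
(* Membership is kept in the filter because [e] is known to be nonzero at [dot z b / theta] only for
   [b] in [rows F r 1]. *)
rewrite big_seq_cond; apply: (@cvg_ext _ _ _ (fun d =>
  \prod_(b <- rows F r 1 | (b \in rows F r 1) && (b != 0))
     (1 - (latpoly z d).[x] / (latpoly z d).[dot z b / theta]))).
  by move=> d; rewrite [RHS]big_seq_cond.
apply: (cvg_prod HC) => b /andP[b1 b0]; apply: (cvgB HC (cvg_cst HC _)).
apply: (cvgM HC (eP x)); apply: (cvgV HC (eP _)).
by rewrite divpts_eq0.
Qed.

End Fixed.
End Existence.

(** * Uniqueness of the exponential *)

Section Uniqueness.
Variables (F : finFieldType) (C : fieldType) (R : realType).
Variables (iota : {rmorphism F -> C}) (theta : C) (absC : C -> R).
Hypothesis HC : is_Cinfty iota theta absC.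
Variable r : nat.
Local Notation q := #|F|.
Local Notation A := (Aemb iota theta).
Local Notation N := r.+1.
Local Notation cvg := (cvgC absC).
Local Notation abs_ge0 := (abs_ge0 HC).
Local Notation absM := (absM HC).
Local Notation dot := (dot iota theta).
Local Notation latpoly := (latpoly iota theta).
Local Notation divpts := (divpts iota theta).
Local Notation divpoly := (divpoly iota theta).
Implicit Types (z : 'cV[C]_N) (b : 'rV[{poly F}]_N).

Lemma rows_mulXn n b : 'X^n *: b \in rows F r n -> b = 0.
Proof.
rewrite mem_rows => /forallP h; apply/rowP => i; have := h i; rewrite !mxE.
have [->//|b0] := eqVneq (b 0 i) 0.
rewrite mulrC size_mulXn // -{2}[n]addn0 leq_add2l leqn0 size_poly_eq0.
by rewrite (negPf b0).
Qed.

Lemma dotZXn z n b : dot z ('X^n *: b) = theta ^+ n * dot z b.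
Proof. by rewrite dotZ rmorphXn /= AembX. Qed.

(** Differences of partial sums are bounded by their largest term, so completeness applies. *)
Lemma cvg_series0 (w : nat -> C) : cvg w 0 -> exists l, cvg (fun n => \sum_(i < n) w i) l.
Proof.
move=> w0; apply: (C_complete HC) => e e0; have [n h] := w0 _ (halfr_gt0 e0).
suff H m k : (n <= m)%N -> absC (\sum_(i < m + k) w i - \sum_(i < m) w i) <= e / 2.
  exists n => m m' nm nm'; apply: le_lt_trans (halfr_lt e0).
  have /orP[mm|mm] := leq_total m m'.
    by rewrite (abs_distC HC) -(subnKC mm) H.
  by rewrite -(subnKC mm) H.
move=> nm; elim: k => [|k IH].
  by rewrite addn0 subrr (abs0 HC) ltW // halfr_gt0.
rewrite addnS big_ord_recr /= addrAC; apply: (abs_addP HC) => //.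
by have := h (m + k)%N (leq_trans nm (leq_addr _ _)); rewrite subr0 => /ltW.
Qed.

Lemma abs_thetaX n : absC (theta ^+ n) = q%:R ^+ n.
Proof. by rewrite (absX HC) (abs_theta HC). Qed.

Lemma abs_div_thetaX x n : absC (x / theta ^+ n) = absC x / q%:R ^+ n.
Proof. by rewrite absM (absV HC) abs_thetaX. Qed.

Lemma div_qX_small (x e : R) : 0 <= x -> 0 < e ->
  exists n0, forall n, (n0 <= n)%N -> x / q%:R ^+ n < e.
Proof.
move=> x0 e0; have x1 : 0 < x + 1 by rewrite ltr_wpDl.
have [n0 h] := geom_small (q_ge2 F R) (divr_gt0 e0 x1); exists n0 => n nn.
have qn m : 0 < q%:R ^+ m :> R by rewrite exprn_gt0 ?q_gt0R.
apply: (@le_lt_trans _ _ (x / q%:R ^+ n0)).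
  by rewrite ler_wpM2l // lef_pV2 ?posrE // ler_weXn2l // ler1n ltnW ?q_gt1.
apply: (@le_lt_trans _ _ ((x + 1) / q%:R ^+ n0)).
  by rewrite ler_wpM2r ?invr_ge0 ?(ltW (qn _)) // lerDl.
by rewrite mulrC -ltr_pdivlMr.
Qed.

(** * Comparison of an arbitrary exponential with the lattice polynomials *)

Section Exponential.
Variables (c : R) (z : 'cV[C]_N).
Hypothesis zc : indep iota theta absC c z.
Variables (e : C -> C) (ec g : nat -> C).
Hypothesis ec0 : ec 0%N = 1.
Hypothesis eS : forall x, seriesC absC (fun i => ec i * x ^+ (q ^ i)) (e x).
Hypothesis eK : forall x, e x = 0 <-> inLattice iota theta z x.
Hypothesis eF : forall x,
  e (theta * x) = theta * e x + \sum_(1 <= i < r.+2) g i * (e x) ^+ (q ^ i).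

Lemma expB : {morph e : x y / x - y}.
Proof.
move=> x y; apply: (cvg_uniq HC (eS _)).
apply: cvg_ext (cvgB HC (eS x) (eS y)) => n.
by rewrite -sumrB; apply: eq_bigr => i _; rewrite (frobB iota) mulrBr.
Qed.

Lemma exp0 : e 0 = 0.
Proof. by rewrite -[in LHS](subrr 0) expB subrr. Qed.

Lemma expD : {morph e : x y / x + y}.
Proof. by move=> x y; rewrite -{1}(opprK y) expB -(sub0r y) expB exp0 sub0r opprK. Qed.

(** Each coefficient is a difference of consecutive partial sums of the series at 1, which are
    eventually bounded. *)
Lemma exp_coef_bounded : exists2 M, 0 < M & forall i, absC (ec i) <= M.
Proof.
have [M M0 [n h]] := cvg_bounded HC (eS 1).
exists (M + \sum_(i < n) absC (ec i)); first by rewrite ltr_wpDr // sumr_ge0 // => i _; apply: abs_ge0.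
move=> i; have s0 (P : pred 'I_n) : 0 <= \sum_(k < n | P k) absC (ec k).
  by rewrite sumr_ge0 // => k _; apply: abs_ge0.
have [ni|ni] := ltnP i n.
  by rewrite (bigD1 (Ordinal ni)) //= addrCA lerDl addr_ge0 ?(ltW M0).
apply: (@le_trans _ _ M); last by rewrite lerDl.
have -> : ec i = \sum_(k < i.+1) ec k * 1 ^+ (q ^ k) - \sum_(k < i) ec k * 1 ^+ (q ^ k).
  by rewrite big_ord_recr /= addrAC subrr add0r expr1n mulr1.
by apply: (abs_subP HC); apply: h => //; apply: leqW.
Qed.

(** The linear coefficient is 1 and every other exponent is at least q, hence at least 2. *)
Lemma exp_near0 : exists2 M, 0 < M &
  forall t, absC t <= 1 -> absC (e t - t) <= M * absC t ^+ 2.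
Proof.
have [M M0 hM] := exp_coef_bounded; exists M => // t t1.
apply: (cvg_dist_le HC (N0 := 1%N) (eS t)) => -[//|n] _.
rewrite big_ord_recl ec0 expn0 expr1 mul1r addrAC subrr add0r.
apply: (abs_sumP HC); first by rewrite mulr_ge0 ?exprn_ge0 ?abs_ge0 ?(ltW M0).
move=> i _; rewrite absM (absX HC); apply: ler_pM; rewrite ?abs_ge0 ?exprn_ge0 ?abs_ge0 //.
rewrite ler_wiXn2l ?abs_ge0 // lift0 expnS.
by rewrite (leq_trans (q_gt1 F)) // leq_pmulr // expn_gt0 (ltnW (q_gt1 F)).
Qed.

Lemma exp_isometry : exists2 delta, 0 < delta <= 1 &
  (forall t, absC t < delta -> absC (e t - t) <= absC t / 2) /\
  (forall t, absC t < delta -> absC (e t) = absC t).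
Proof.
have [M M0 hM] := exp_near0.
(* Below [(2 * M)^-1] the remainder [M * absC t ^+ 2] is at most [absC t / 2]. *)
pose delta := Num.min 1 (2 * M)^-1.
have d0 : 0 < delta by rewrite lt_min ltr01 invr_gt0 mulr_gt0.
have h t : absC t < delta -> absC (e t - t) <= absC t / 2.
  rewrite lt_min => /andP[t1 tM]; apply: le_trans (hM _ (ltW t1)) _.
  rewrite expr2 mulrA mulrC ler_wpM2l ?abs_ge0 //.
  have : absC t * (2 * M) < 1 by rewrite -ltr_pdivlMr ?mulr_gt0 // mul1r.
  lra.
exists delta; first by rewrite d0 ge_min lexx.
split=> // t td; have [->|t0] := eqVneq t 0; first by rewrite exp0.
apply: (abs_dist_eq HC); apply: le_lt_trans (h t td) _.
by rewrite halfr_lt // (abs_gt0 HC).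
Qed.

(** Successive approximation: iterating [t - e t] from [w] at least halves the absolute value each
    time, and by additivity [e] of the k-th partial sum of the iterates telescopes to [w - v k].
    Their sum is the preimage. *)
Lemma exp_local_surj delta : 0 < delta <= 1 ->
  (forall t, absC t < delta -> absC (e t - t) <= absC t / 2) ->
  (forall t, absC t < delta -> absC (e t) = absC t) ->
  forall w, absC w < delta -> exists2 y, absC y <= absC w & e y = w.
Proof.
move=> /andP[d0 d1] h1 h2 w wd.
have [v vw vS] : exists2 v : nat -> C, v 0%N = w & forall k, v k.+1 = v k - e (v k).
  by exists (fun k => iter k (fun t => t - e t) w).
have vB k : absC (v k) <= absC w / 2 ^+ k.
  elim: k => [|k IH]; first by rewrite vw expr0 divr1.
  have vk : absC (v k) < delta.
    apply: le_lt_trans IH _; apply: le_lt_trans wd.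
    by rewrite ler_pdivrMr ?exprn_gt0 // ler_peMr ?abs_ge0 // exprn_ege1 // ler1n.
  rewrite vS (abs_distC HC) (le_trans (h1 _ vk)) //.
  by rewrite exprSr invfM mulrA ler_wpM2r // invr_ge0.
have v0 : cvg v 0.
  move=> eps eps0; have w1 : 0 < absC w + 1 by rewrite ltr_wpDl ?abs_ge0.
  have [k0 hk] := geom_small (lexx 2) (divr_gt0 eps0 w1).
  exists k0 => k kk; rewrite subr0; apply: le_lt_trans (vB k) _.
  apply: (@le_lt_trans _ _ ((absC w + 1) / 2 ^+ k0)); last by rewrite mulrC -ltr_pdivlMr.
  apply: ler_pM; rewrite ?abs_ge0 ?invr_ge0 ?exprn_ge0 ?lerDl //.
  by rewrite lef_pV2 ?posrE ?exprn_gt0 // ler_weXn2l // ler1n.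
have [y hy] := cvg_series0 v0.
have eY k : e (\sum_(i < k) v i) = w - v k.
  elim: k => [|k IH]; first by rewrite big_ord0 exp0 vw subrr.
  by rewrite big_ord_recr /= expD IH vS opprB addrA addrAC.
exists y.
  apply: (cvg_le HC (N0 := 0%N) hy) => k _; apply: (abs_sumP HC) => [|i _]; first exact: abs_ge0.
  apply: le_trans (vB _) _.
  by rewrite ler_pdivrMr ?exprn_gt0 // ler_peMr ?abs_ge0 // exprn_ege1 // ler1n.
apply: (eq_of_small HC) => eps eps0; pose m := Num.min delta eps.
have m0 : 0 < m by rewrite lt_min d0 eps0.
have [k1 hk1] := hy _ m0; have [k2 hk2] := v0 _ m0.
pose k := maxn k1 k2.
(* Additivity together with the isometry near 0 plays the part of continuity of [e] at [y]. *)
have -> : e y - w = - e (\sum_(i < k) v i - y) - v k by rewrite expB eY; ring.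
have := hk1 k (leq_maxl _ _); rewrite lt_min => /andP[ld le].
apply: (abs_subP HC); first by rewrite (absN HC) h2 // ltW.
have := hk2 k (leq_maxr _ _); rewrite subr0 lt_min => /andP[_ /ltW]; exact.
Qed.

(* If [e x] is small, it is [e y] with [y] small; then [x - y] is a lattice point, zero
   because the coordinates of [x] have absolute value < 1. *)
Lemma exp_torsion_ge delta : 0 < delta <= 1 ->
  (forall t, absC t < delta -> absC (e t - t) <= absC t / 2) ->
  (forall t, absC t < delta -> absC (e t) = absC t) ->
  forall n b, b \in rows F r n -> delta <= absC (dot z b / theta ^+ n) ->
  Num.min delta c <= absC (e (dot z b / theta ^+ n)).
Proof.
move=> d01 h1 h2 n b bn; set x := _ / _ => xd; rewrite leNgt lt_min; apply/negP => /andP[ed ecc].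
have [y ye eyx] := exp_local_surj d01 h1 h2 ed.
have /eK/inLatticeP[b' xyb] : e (x - y) = 0 by rewrite expB eyx subrr.
have tn : theta ^+ n != 0 by rewrite expf_neq0 // (theta_neq0 HC).
have yE : y = dot z (b - 'X^n *: b') / theta ^+ n.
  by rewrite dotB dotZXn -xyb mulrBl mulrAC divff // mul1r; rewrite /x; ring.
(* A row with an entry of degree at least n would give [absC y >= c]. Otherwise ['X^n *: b'] has
   degree below n, so [b' = 0] and [x = y], contradicting the lower bound on [x]. *)
have [hr|hr] := boolP (b - 'X^n *: b' \in rows F r n); last first.
  have := indep_far HC zc hr; rewrite leNgt => /negP; apply.
  rewrite -ltr_pdivrMr ?exprn_gt0 ?q_gt0R // -abs_div_thetaX -yE.
  exact: le_lt_trans ye ecc.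
have b'0 : b' = 0.
  apply: (@rows_mulXn n); have -> : 'X^n *: b' = b - (b - 'X^n *: b') by rewrite opprB subrKC.
  exact: rowsB.
move: xyb; rewrite b'0 dot0 => /eqP; rewrite subr_eq0 => /eqP xy.
have := le_lt_trans ye ed; rewrite -xy ltNge xd; done.
Qed.

Definition theta_poly : {poly C} :=
  theta *: 'X + \sum_(1 <= i < r.+2) g i *: 'X^(q ^ i).

Lemma theta_poly_horner x : theta_poly.[e x] = e (theta * x).
Proof.
rewrite eF hornerD hornerZ hornerX horner_sum; congr (_ + _).
by apply: eq_bigr => i _; rewrite hornerZ hornerXn.
Qed.

Lemma size_theta_poly : (size theta_poly <= (q ^ N).+1)%N.
Proof.
have q0 k : (0 < q ^ k)%N by rewrite expn_gt0 (ltnW (q_gt1 F)).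
rewrite (leq_trans (size_polyD _ _)) // geq_max; apply/andP; split.
  by apply: leq_trans (size_scale_leq _ _) _; rewrite size_polyX ltnS.
rewrite big_nat; apply: (leq_trans (size_sum _ _ _)); apply/bigmax_leqP_seq => i _ /andP[_ ir].
apply: leq_trans (size_scale_leq _ _) _; rewrite size_polyXn ltnS.
by rewrite leq_exp2l ?q_gt1.
Qed.

Lemma theta_poly_deriv : theta_poly^`().[0] = theta.
Proof.
rewrite derivD derivZ derivX raddf_sum hornerD hornerZ -polyC1 hornerC mulr1.
rewrite horner_sum big_nat big1 ?addr0 // => i /andP[i1 _] /=.
rewrite derivZ derivXn hornerZ hornerMn hornerXn.
by rewrite -mulr_natr natrX (natq_eq0 iota) [0 ^+ i]expr0n gtn_eqF // !mulr0.
Qed.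

(** This is the polynomial of phi at theta^n. *)
Definition theta_iter n : {poly C} := iter n (fun p => theta_poly \Po p) 'X.

Lemma theta_iter_horner n x : (theta_iter n).[e x] = e (theta ^+ n * x).
Proof.
elim: n => [|n IH]; first by rewrite hornerX mul1r.
by rewrite /theta_iter iterS horner_comp -/(theta_iter n) IH theta_poly_horner mulrA exprS.
Qed.

Lemma theta_iter_deriv n : (theta_iter n)^`().[0] = theta ^+ n.
Proof.
elim: n => [|n IH]; first by rewrite derivX -polyC1 hornerC.
have h0 : (theta_iter n).[0] = 0 by rewrite -exp0 theta_iter_horner mulr0.
rewrite /theta_iter iterS -/(theta_iter n) deriv_comp hornerM horner_comp h0.
by rewrite theta_poly_deriv IH exprS.
Qed.

Lemma size_theta_iter n : (size (theta_iter n) <= (q ^ (N * n)).+1)%N.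
Proof.
elim: n => [|n IH]; first by rewrite muln0 size_polyX.
rewrite /theta_iter iterS -/(theta_iter n).
apply: leq_trans (size_comp_poly_leq _ _) _; rewrite ltnS mulnS expnD.
by apply: leq_mul; rewrite -subn1 leq_subLR add1n // size_theta_poly.
Qed.

Lemma exp_torsion_eq0 n b : b \in rows F r n -> e (dot z b / theta ^+ n) = 0 -> b = 0.
Proof.
move=> bn /eK/inLatticeP[b' eb].
have tn : theta ^+ n != 0 by rewrite expf_neq0 // (theta_neq0 HC).
have bE : b = 'X^n *: b'.
  apply/eqP; rewrite -subr_eq0; apply/eqP/(indep_inj HC zc).
  by rewrite dotB dotZXn -eb mulrC divfK ?subrr.
by have := bn; rewrite bE => /rows_mulXn ->; rewrite scaler0.
Qed.

(* [theta_iter n] is the polynomial of degree q^(N n) vanishing at the images under [e] of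
   the [theta ^+ n]-division points. *)
Lemma exp_prod n y : e y = theta ^+ n * (e (y / theta ^+ n) *
  \prod_(b <- rows F r n | b != 0) (1 - e (y / theta ^+ n) / e (dot z b / theta ^+ n))).
Proof.
have tn : theta ^+ n != 0 by rewrite expf_neq0 // (theta_neq0 HC).
pose rs := [seq e (dot z b / theta ^+ n) | b <- rows F r n].
have rs0 : 0 \in rs by apply/mapP; exists 0; rewrite ?rows0 // dot0 mul0r exp0.
have urs : uniq rs.
  rewrite map_inj_in_uniq ?uniq_rows // => b b' hb hb' /eqP.
  rewrite -subr_eq0 -expB -mulrBl -dotB => /eqP/exp_torsion_eq0 h.
  by apply/eqP; rewrite -subr_eq0 h // rowsB.
have E : theta_iter n = theta ^+ n *: nprod rs.
  rewrite -theta_iter_deriv; apply: poly_of_roots => //.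
    apply/allP => _ /mapP[b bn ->]; rewrite rootE theta_iter_horner mulrC divfK //.
    by apply/eqP/eK/inLatticeP; exists b.
  by rewrite size_map size_rows size_theta_iter.
rewrite -[in LHS](divfK tn y) [_ * theta ^+ n]mulrC -theta_iter_horner E hornerZ horner_nprod.
congr (_ * (_ * _)); rewrite big_map big_seq_cond [RHS]big_seq_cond; apply: eq_bigl => b.
case: (boolP (b \in _)) => //= bn.
by apply/idP/idP; apply: contraNN => /eqP; [move->; rewrite dot0 mul0r exp0
  | move/(exp_torsion_eq0 bn) => ->].
Qed.

(** The quadratic remainder of [exp_near0], multiplied by theta^n, is at most
    [M * absC x ^+ 2 / q^n]. *)
Lemma cvg_exp_scaled x : cvg (fun n => theta ^+ n * e (x / theta ^+ n)) x.
Proof.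
have [M M0 hM] := exp_near0; move=> eps eps0.
have ax2 : 0 <= M * absC x ^+ 2 by rewrite mulr_ge0 ?exprn_ge0 ?abs_ge0 ?(ltW M0).
have [n1 h1] := div_qX_small (abs_ge0 x) ltr01.
have [n2 h2] := div_qX_small ax2 eps0.
exists (maxn n1 n2) => n; rewrite geq_max => /andP[/h1 hn1 /h2 hn2].
have tn : theta ^+ n != 0 by rewrite expf_neq0 // (theta_neq0 HC).
rewrite -{2}(divfK tn x) [_ / _ * _]mulrC -mulrBr absM abs_thetaX.
have qn : 0 < q%:R ^+ n :> R by rewrite exprn_gt0 ?q_gt0R.
have := hM (x / theta ^+ n); rewrite abs_div_thetaX => /(_ (ltW hn1)) h.
apply: le_lt_trans (ler_wpM2l (ltW qn) h) _; apply: le_lt_trans hn2.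
have -> // : q%:R ^+ n * (M * (absC x / q%:R ^+ n) ^+ 2) = M * absC x ^+ 2 / q%:R ^+ n.
by field; rewrite gt_eqF.
Qed.

(** For large n the numerator has absolute value [absC y / q^n]. The denominator is at least
    [c * q^d / q^n]: by the isometry if its argument is small, and by [exp_torsion_ge] otherwise,
    since [n2] puts that quantity below [Num.min delta c]. *)
Lemma exp_tail y d : exists n0, forall n, (n0 <= n)%N -> forall b, b \in rows F r n ->
  b \notin rows F r d ->
  absC (e (y / theta ^+ n) / e (dot z b / theta ^+ n)) <= absC y / (c * q%:R ^+ d).
Proof.
have [delta d01 [h1 h2]] := exp_isometry; have [d0 _] := andP d01.
have c0 : 0 < c by case: zc.
have m0 : 0 < Num.min delta c by rewrite lt_min d0 c0.
have [n1 hn1] := div_qX_small (abs_ge0 y) d0.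
have [n2 hn2] := div_qX_small (ltW (radius_ge0 zc d)) m0.
exists (maxn n1 n2) => n; rewrite geq_max => /andP[/hn1 k1 /hn2 k2] b bn bd.
have qn : 0 < q%:R ^+ n :> R by rewrite exprn_gt0 ?q_gt0R.
have eE : absC (e (dot z b / theta ^+ n)) >= c * q%:R ^+ d / q%:R ^+ n.
  have [bs|bs] := ltP (absC (dot z b / theta ^+ n)) delta.
    by rewrite h2 // abs_div_thetaX ler_wpM2r ?invr_ge0 ?(ltW qn) // (indep_far HC zc).
  by apply: le_trans (exp_torsion_ge d01 h1 h2 bn bs); apply: ltW.
have p0 : 0 < c * q%:R ^+ d / q%:R ^+ n by rewrite divr_gt0 ?(radius_ge0 zc).
rewrite absM (absV HC) h2 ?abs_div_thetaX //.
apply: (@le_trans _ _ (absC y / q%:R ^+ n / (c * q%:R ^+ d / q%:R ^+ n))).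
  rewrite ler_wpM2l ?divr_ge0 ?abs_ge0 ?(ltW qn) // lef_pV2 ?posrE //.
  exact: lt_le_trans eE.
rewrite le_eqVlt; apply/orP; left; apply/eqP; field.
by rewrite !gt_eqF ?exprn_gt0 ?q_gt0R.
Qed.

(** In [exp_prod n] the factors with [b] in [rows F r d] tend to [(latpoly z d).[y]] as n grows,
    while the others have a product close to 1 by [exp_tail]. The left side [e y] does not depend on
    n. *)
Lemma exp_latpoly_le y d : absC y <= c * q%:R ^+ d -> (latpoly z d).[y] != 0 ->
  absC ((latpoly z d).[y] - e y) <= absC (latpoly z d).[y] * (absC y / (c * q%:R ^+ d)).
Proof.
move=> yd n0.
pose u n := e (y / theta ^+ n); pose v n b := e (dot z b / theta ^+ n).
pose An n := theta ^+ n * u n * \prod_(b <- rows F r d | b != 0) (1 - u n / v n b).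
have AnE : cvg An (latpoly z d).[y].
  rewrite (latpolyE HC zc) hornerM hornerX horner_prod.
  apply: (cvgM HC (cvg_exp_scaled y)); apply: (cvg_prod HC) => b b0.
  rewrite hornerD hornerN hornerZ hornerX -polyC1 hornerC; apply: (cvgB HC (cvg_cst HC _)).
  apply: (@cvg_ext _ _ _ (fun n => (theta ^+ n * v n b)^-1 * (theta ^+ n * u n))).
    by move=> n; rewrite invfM mulrACA mulVf ?expf_neq0 ?(theta_neq0 HC) // mul1r mulrC.
  apply: (cvgM HC _ (cvg_exp_scaled y)).
  by apply: (cvgV HC (cvg_exp_scaled _)); apply: (dot_neq0 HC zc).
have [n1 h1] := exp_tail y d; have [n2 h2] := cvg_abs HC AnE n0.
apply: (cvg_dist_le HC (N0 := maxn d (maxn n1 n2)) AnE) => n.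
rewrite !geq_max => /and3P[dn /h1 k1 /h2 <-].
have -> : e y = An n * \prod_(b <- rows F r n | b \notin rows F r d) (1 - u n / v n b).
  by rewrite [LHS](exp_prod n) -/(u n) /An (prod_rows_split _ dn) -!mulrA.
rewrite (abs_distC HC) -{2}[An n]mulr1 -mulrBr absM ler_wpM2l ?abs_ge0 //.
rewrite big_seq_cond; apply: (abs_prod_sub1 HC) => [|b /andP[bn bd]].
  by rewrite divr_ge0 ?abs_ge0 ?(ltW (radius_ge0 zc _)) //= ler_pdivrMr ?(radius_ge0 zc) // mul1r.
by rewrite (absN HC) k1.
Qed.

Lemma cvg_latpoly_exp y : cvg (fun d => (latpoly z d).[y]) (e y).
Proof.
have [yL|yL] := classic (inLattice iota theta z y).
  have [D h] := latpoly_lattice yL; have -> : e y = 0 by apply/eK.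
  by apply: (cvg_eventually (N0 := D)) (cvg_cst HC 0) => d Dd; rewrite h.
have [D h] := latpoly_nonlattice HC zc yL.
move=> eps eps0; pose K := absC (latpoly z D).[y].
have [D1 k1] := radius_large zc (absC y); have [D2 k2] := radius_large zc (K * absC y / eps).
exists (maxn D (maxn D1 D2)) => d; rewrite !geq_max => /and3P[/h[hK n0] /k1 hd1 /k2 hd2].
apply: le_lt_trans (exp_latpoly_le (ltW hd1) n0) _; rewrite hK -/K.
rewrite mulrA ltr_pdivrMr ?(radius_ge0 zc) // [eps * _]mulrC -ltr_pdivrMr //.
Qed.

(** The leading coefficient of [divpoly f z]; [f] will be the exponential or a [latpoly z d]. *)
Definition Delta_prod (f : C -> C) :=
  theta * \prod_(b <- rows F r 1 | b != 0) (- (f (dot z b / theta))^-1).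

Lemma exp_div_neq0 b : b \in rows F r 1 -> b != 0 -> e (dot z b / theta) != 0.
Proof.
move=> b1; apply: contraNneq => h; apply/eqP/(exp_torsion_eq0 b1).
by rewrite expr1.
Qed.

(** [theta_poly] has linear coefficient theta, vanishes at the division values and has degree at
    most their number, so it is [divpoly e z]. *)
Lemma lead_theta_poly : g N = Delta_prod e.
Proof.
have u : uniq (divpts e z) by apply: (uniq_divpts HC (indep_inj HC zc) expB) => x /eK.
have E : theta_poly = divpoly e z.
  rewrite /divpoly -{1}theta_poly_deriv; apply: poly_of_roots => //.
  - by apply: divpts0; exact: exp0.
  - apply/allP => _ /mapP[b b1 ->]; rewrite rootE theta_poly_horner mulrC divfK ?(theta_neq0 HC) //.
    by apply/eqP/eK/inLatticeP; exists b.
  - by rewrite size_divpts size_theta_poly.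
rewrite /Delta_prod -(lead_divpoly (z := z) exp0 u) -E coefD coefZ coefX.
rewrite gtn_eqF ?mulr0 ?add0r; last first.
  by rewrite expnS (leq_trans (q_gt1 F)) // leq_pmulr // expn_gt0 (ltnW (q_gt1 F)).
rewrite coef_sum big_nat_recr //= coefZ coefXn eqxx mulr1 big_nat big1 ?add0r // => i /andP[_ ir].
by rewrite coefZ coefXn eqn_exp2l ?q_gt1 // gtn_eqF ?mulr0.
Qed.

Lemma cvg_Delta_prod : cvg (fun d => Delta_prod (horner (latpoly z d))) (g N) /\ g N != 0.
Proof.
rewrite lead_theta_poly; split; last first.
  rewrite mulf_neq0 ?(theta_neq0 HC) // big_seq_cond prodf_seq_neq0; apply/allP => b _.
  by apply/implyP => /andP[b1 b0]; rewrite oppr_eq0 invr_eq0 exp_div_neq0.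
apply: (cvgM HC (cvg_cst HC _)); rewrite big_seq_cond.
apply: (@cvg_ext _ _ _ (fun d => \prod_(b <- rows F r 1 | (b \in rows F r 1) && (b != 0))
     - ((latpoly z d).[dot z b / theta])^-1)).
  by move=> d; rewrite [RHS]big_seq_cond.
apply: (cvg_prod HC) => b /andP[b1 b0]; apply: (cvgN HC); apply: (cvgV HC (cvg_latpoly_exp _)).
exact: exp_div_neq0.
Qed.

End Exponential.
End Uniqueness.

(** * Differentiability of the discriminant *)

Section Discriminant.
Variables (F : finFieldType) (C : fieldType) (R : realType).
Variables (iota : {rmorphism F -> C}) (theta : C) (absC : C -> R).
Hypothesis HC : is_Cinfty iota theta absC.
Variable r : nat.
Local Notation q := #|F|.
Local Notation A := (Aemb iota theta).
Local Notation N := r.+1.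
Local Notation cvg := (cvgC absC).
Local Notation abs_ge0 := (abs_ge0 HC).
Local Notation absM := (absM HC).
Local Notation dot := (dot iota theta).
Local Notation latpoly := (latpoly iota theta).
Local Notation Delta_prod := (Delta_prod iota theta).
Local Notation indep := (indep iota theta absC).
Local Notation Delta := (Delta iota theta absC).
Local Notation IsDrinfeld := (IsDrinfeld iota theta absC).
Implicit Types (z h w : 'cV[C]_N) (b : 'rV[{poly F}]_N) (c eta : R).

Lemma Drinfeld_cvg c z g : indep c z -> IsDrinfeld z g ->
  cvg (fun d => Delta_prod z (horner (latpoly z d))) (g N) /\ g N != 0.
Proof. by move=> zc [e [ec [e1 [eS [eK eF]]]]]; apply: (cvg_Delta_prod HC zc e1 eS eK eF). Qed.

Lemma Delta_Drinfeld c z : indep c z -> IsDrinfeld z (drinfeld_coeffs iota theta absC z).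
Proof.
move=> zc; apply: epsilon_spec.
have [e [ec [g [e1 eS eK eF _]]]] := exists_Drinfeld HC zc.
by exists g, e, ec.
Qed.

Lemma Delta_cvg c z : indep c z ->
  cvg (fun d => Delta_prod z (horner (latpoly z d))) (Delta z).
Proof. by move=> zc; have [] := Drinfeld_cvg zc (Delta_Drinfeld zc). Qed.

Lemma Delta_neq0 c z : indep c z -> Delta z != 0.
Proof. by move=> zc; have [] := Drinfeld_cvg zc (Delta_Drinfeld zc). Qed.

(** The new exponential is [t^-1 e(t x)], which conjugates the Drinfeld module by [t]. The exponent
    q^i - 1 is written as a quotient. *)
Lemma Drinfeld_scale z z' t g : t != 0 ->
  (forall x, inLattice iota theta z' x <-> inLattice iota theta z (t * x)) ->
  IsDrinfeld z g -> IsDrinfeld z' (fun i => t ^+ (q ^ i) / t * g i).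
Proof.
move=> t0 zz [e [ec [e1 [eS [eK eF]]]]].
exists (fun x => t^-1 * e (t * x)), (fun i => t ^+ (q ^ i) / t * ec i).
split; first by rewrite expn0 expr1 divff // mul1r.
split.
  move=> x; apply: cvg_ext (cvgM HC (cvg_cst HC t^-1) (eS (t * x))) => n.
  by rewrite mulr_sumr; apply: eq_bigr => i _; rewrite exprMn /qF; ring.
split.
  move=> x; rewrite zz -eK; split=> [/eqP|->]; last by rewrite mulr0.
  by rewrite mulf_eq0 invr_eq0 (negPf t0) => /eqP.
move=> x; rewrite mulrCA eF mulrDr mulrCA; congr (_ + _).
rewrite mulr_sumr; apply: eq_bigr => i _; rewrite /qF exprMn exprVn.
by field; rewrite t0 expf_neq0.
Qed.

(** Covers homogeneity and invariance under change of basis together. As [indep] is given for [z]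
    alone, the module chosen for [z'] is carried back to [z], where the discriminant is unique. *)
Lemma Delta_scale c z z' t : indep c z -> t != 0 ->
  (forall x, inLattice iota theta z' x <-> inLattice iota theta z (t * x)) ->
  Delta z' * t = t ^+ (q ^ N) * Delta z.
Proof.
move=> zc t0 zz; have ti0 : t^-1 != 0 by rewrite invr_eq0.
have H := Delta_Drinfeld zc; have H' := Drinfeld_scale t0 zz H.
have Hz' : IsDrinfeld z' (drinfeld_coeffs iota theta absC z').
  by apply: epsilon_spec; eexists; exact: H'.
have zz' x : inLattice iota theta z x <-> inLattice iota theta z' (t^-1 * x).
  by rewrite zz mulVKf.
have H2 := Drinfeld_scale ti0 zz' Hz'.
have := cvg_uniq HC (Delta_cvg zc) (proj1 (Drinfeld_cvg zc H2)); rewrite /Delta => ->.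
have T0 : t ^+ (q ^ N) != 0 by rewrite expf_neq0.
by rewrite exprVn; move: (t ^+ (q ^ N)) T0 => T T0; field; rewrite t0 T0 oner_neq0.
Qed.

(** * Logarithmic derivatives with a uniform quadratic remainder *)

Definition lin (l : 'I_N -> C) h : C := \sum_i l i * h i 0.

Lemma linD l l' h : lin (fun i => l i + l' i) h = lin l h + lin l' h.
Proof. by rewrite /lin -big_split; apply: eq_bigr => i _; rewrite mulrDl. Qed.

Lemma linN l h : lin (fun i => - l i) h = - lin l h.
Proof. by rewrite /lin -sumrN; apply: eq_bigr => i _; rewrite mulNr. Qed.

Lemma linZ l s h : lin l (s *: h) = s * lin l h.
Proof. by rewrite /lin mulr_sumr; apply: eq_bigr => i _; rewrite mxE mulrCA. Qed.

Definition small c eta h := 0 <= eta < 1 /\ forall i, absC (h i 0) <= eta * c.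

(* The bound [eta ^+ 2] does not depend on [f]: this is what allows passing to limits. *)
Definition logdiff c z (f : 'cV[C]_N -> C) (l : 'I_N -> C) :=
  f z != 0 /\ forall eta h, small c eta h ->
    absC (lin l h) <= eta /\ absC (f (z + h) / f z - 1 - lin l h) <= eta ^+ 2.

Lemma small_sqr eta : 0 <= eta < 1 -> eta ^+ 2 <= eta.
Proof. by move=> /andP[e0 e1]; rewrite expr2 ler_piMr ?(ltW e1). Qed.

Lemma logdiff_le c z f l eta h : logdiff c z f l -> small c eta h ->
  absC (f (z + h) / f z - 1) <= eta.
Proof.
move=> [_ H] hs; have [h1 h2] := H _ _ hs.
rewrite -(subrK (lin l h) (_ - 1)); apply: (abs_addP HC) => //.
by apply: le_trans h2 (small_sqr _); case: hs.
Qed.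

Lemma logdiff_ext c z f f' l : (forall x, f x = f' x) -> logdiff c z f l -> logdiff c z f' l.
Proof. by move=> ff [f0 H]; split=> [|eta h /H]; rewrite -!ff. Qed.

Lemma logdiff_cst c z a : a != 0 -> logdiff c z (fun=> a) (fun=> 0).
Proof.
move=> a0; split=> // eta h [/andP[e0 _] _].
have -> : lin (fun=> 0) h = 0 by rewrite /lin big1 // => i _; rewrite mul0r.
by rewrite divff // subrr subr0 (abs0 HC) exprn_ge0.
Qed.

(** From [(1 + u)(1 + v) - 1 = u + v + u v]: the cross term is at most [eta ^+ 2], and the
    ultrametric inequality takes a maximum instead of adding errors. *)
Lemma logdiffM c z f f' l l' : logdiff c z f l -> logdiff c z f' l' ->
  logdiff c z (fun x => f x * f' x) (fun i => l i + l' i).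
Proof.
move=> H H'; have [f0 K] := H; have [f0' K'] := H'; split=> [|eta h hs].
  exact: mulf_neq0.
have [k1 k2] := K _ _ hs; have [k1' k2'] := K' _ _ hs; rewrite linD.
split; first exact: (abs_addP HC).
have u1 := logdiff_le H hs; have u2 := logdiff_le H' hs.
set u := f (z + h) / f z - 1 in k2 u1; set v := f' (z + h) / f' z - 1 in k2' u2.
have -> : f (z + h) * f' (z + h) / (f z * f' z) - 1 - (lin l h + lin l' h)
   = (u - lin l h) + (v - lin l' h) + u * v by rewrite /u /v; field; rewrite f0 f0'.
do 2?[apply: (abs_addP HC) => //].
by rewrite absM expr2 ler_pM ?abs_ge0.
Qed.

Lemma logdiffV c z f l : logdiff c z f l ->
  logdiff c z (fun x => (f x)^-1) (fun i => - l i).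
Proof.
move=> H; have [f0 K] := H; split=> [|eta h hs]; first by rewrite invr_eq0.
have [k1 k2] := K _ _ hs; rewrite linN (absN HC); split=> //.
have u1 := logdiff_le H hs; set u := f (z + h) / f z - 1 in k2 u1.
have au : absC (1 + u) = 1.
  by apply: (abs_1D HC); apply: le_lt_trans u1 _; case: hs => /andP[].
have u0 : 1 + u != 0 by apply: (abs_neq0 HC); rewrite au.
have fE : f (z + h) = f z * (1 + u) by rewrite /u; field.
have -> : (f (z + h))^-1 / (f z)^-1 - 1 - - lin l h = (lin l h * u - (u - lin l h)) / (1 + u).
  by rewrite fE; field; rewrite u0 f0 oner_neq0.
rewrite absM (absV HC) au invr1 mulr1; apply: (abs_subP HC) => //.
by rewrite absM expr2 ler_pM ?abs_ge0.
Qed.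

(** A linear form has no quadratic remainder, and [indep] bounds each term [A (b 0 i) * h i 0] by
    [eta * absC (dot z b)]. *)
Lemma logdiff_dot c z b : indep c z -> b != 0 ->
  exists l, logdiff c z (fun x => dot x b) l.
Proof.
move=> zc b0; have d0 := dot_neq0 HC zc b0; have [c0 ci] := zc.
exists (fun i => A (b 0 i) / dot z b); split=> // eta h [/andP[e0 e1] hs].
have -> : lin (fun i => A (b 0 i) / dot z b) h = dot h b / dot z b.
  by rewrite /lin mulr_suml; apply: eq_bigr => i _; rewrite mulrAC.
have -> : dot (z + h) b = dot z b + dot h b.
  by rewrite -big_split; apply: eq_bigr => i _; rewrite mxE mulrDr.
split; last first.
  have -> : (dot z b + dot h b) / dot z b - 1 - dot h b / dot z b = 0 by field.
  by rewrite (abs0 HC) exprn_ge0.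
rewrite absM (absV HC) ler_pdivrMr ?(abs_gt0 HC) //.
apply: (abs_sumP HC) => [|i _]; first by rewrite mulr_ge0 ?abs_ge0.
rewrite absM mulrC; apply: le_trans (ler_wpM2r (abs_ge0 _) (hs i)) _.
by rewrite -mulrA ler_wpM2l.
Qed.

Lemma logdiff_prod c z (I : Type) (s : seq I) (P : pred I) (f : I -> 'cV[C]_N -> C) :
  (forall i, P i -> exists l, logdiff c z (f i) l) ->
  exists l, logdiff c z (fun x => \prod_(i <- s | P i) f i x) l.
Proof.
move=> H; elim: s => [|i s [l IH]].
  exists (fun=> 0); apply: logdiff_ext (logdiff_cst _ _ (oner_neq0 C)) => x.
  by rewrite big_nil.
have [/[dup] Pi /H[l' Hi]|Pi] := boolP (P i).
  by eexists; apply: logdiff_ext (logdiffM Hi IH) => x; rewrite big_cons Pi.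
by exists l; apply: logdiff_ext IH => x; rewrite big_cons (negPf Pi).
Qed.

(* A closed formula in linear forms of [z], to which [logdiff_dot] applies. *)
Definition Delta_approx d z : C :=
  theta * \prod_(b <- rows F r 1 | (b \in rows F r 1) && (b != 0))
    (-1 * (theta^-1 * dot z b * \prod_(b' <- rows F r d | b' != 0)
       (theta^-1 * dot z ('X *: b' - b) * (dot z b')^-1))^-1).

Lemma Delta_approxE c d z : indep c z ->
  Delta_approx d z = Delta_prod z (horner (latpoly z d)).
Proof.
move=> zc; rewrite /Delta_prod; congr (_ * _); rewrite [RHS]big_seq_cond.
apply: eq_bigr => b _; rewrite mulN1r; congr (- _^-1).
rewrite (latpolyE HC zc) hornerM hornerX horner_prod [dot z b / theta]mulrC; congr (_ * _).
apply: eq_bigr => b' b'0; rewrite hornerD hornerN hornerZ hornerX -polyC1 hornerC.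
(* Each factor [1 - (b.z / theta) / b'.z] is [theta^-1 (theta b' - b).z / b'.z]. *)
rewrite dotB dotZX; field.
by rewrite (theta_neq0 HC) (dot_neq0 HC zc).
Qed.

Lemma logdiff_Delta_approx c d z : indep c z -> exists l, logdiff c z (Delta_approx d) l.
Proof.
move=> zc; have t0 := theta_neq0 HC; have ti0 : theta^-1 != 0 by rewrite invr_eq0.
have m1 : -1 != 0 :> C by rewrite oppr_eq0 oner_eq0.
suff [l H] : exists l, logdiff c z (fun z => \prod_(b <- rows F r 1 | (b \in rows F r 1) && (b != 0))
    (-1 * (theta^-1 * dot z b * \prod_(b' <- rows F r d | b' != 0)
       (theta^-1 * dot z ('X *: b' - b) * (dot z b')^-1))^-1)) l.
  by eexists; apply: (logdiffM (logdiff_cst c z t0) H).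
apply: logdiff_prod => b /andP[b1 b0].
have [l1 H1] := logdiff_dot zc b0.
suff [l2 H2] : exists l, logdiff c z (fun z => \prod_(b' <- rows F r d | b' != 0)
       (theta^-1 * dot z ('X *: b' - b) * (dot z b')^-1)) l.
  eexists; apply: (logdiffM (logdiff_cst c z m1)); apply: logdiffV.
  exact: (logdiffM (logdiffM (logdiff_cst c z ti0) H1) H2).
apply: logdiff_prod => b' b'0.
(* A nonzero row of constants is not a multiple of ['X], so this linear form does not vanish. *)
have bb : 'X *: b' - b != 0.
  apply: contra b0; rewrite subr_eq0 => /eqP e; apply/eqP.
  exact: rows1_mulX b1 (esym e).
have [l3 H3] := logdiff_dot zc bb; have [l4 H4] := logdiff_dot zc b'0.
eexists; exact: (logdiffM (logdiffM (logdiff_cst c z ti0) H3) (logdiffV H4)).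
Qed.

(** By [logdiff_dot] the ratio of the two values of each nonzero linear form is within [eta < 1] of
    1, so absolute values do not change. *)
Lemma indep_near c z eta h : indep c z -> small c eta h -> indep c (z + h).
Proof.
move=> zc hs; have [c0 ci] := zc; split=> // b i.
have [->|b0] := eqVneq b 0; first by rewrite mxE rmorph0 (abs0 HC) mulr0 abs_ge0.
have [l H] := logdiff_dot zc b0; have d0 := dot_neq0 HC zc b0.
have := logdiff_le H hs; set u := _ / _ - 1 => ue.
have -> : dot (z + h) b = dot z b * (1 + u) by rewrite /u; field.
by rewrite absM (abs_1D HC) ?mulr1 //; apply: le_lt_trans ue _; case: hs => /andP[].
Qed.

Lemma small_delta c eta s i : 0 < c -> 0 <= eta < 1 -> absC s <= eta * c ->
  small c eta (s *: delta_mx i 0).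
Proof.
move=> c0 e01 hs; split=> // j; rewrite !mxE; case: (_ && _); rewrite ?mulr1 //.
by rewrite mulr0 (abs0 HC) mulr_ge0 ?(ltW c0) //; case/andP: e01.
Qed.

Lemma lin_delta l s i : lin l (s *: delta_mx i 0) = s * l i.
Proof.
rewrite linZ /lin (bigD1 i) //= big1 ?addr0 => [|j ji].
  by rewrite mxE !eqxx mulr1.
by rewrite mxE (negPf ji) mulr0.
Qed.

Lemma thetaV_small (e : R) : 0 < e -> exists s, s != 0 /\ absC s < e.
Proof.
move=> e0; have [k hk] := geom_small (q_ge2 F R) e0.
exists (theta ^+ k)^-1; rewrite invr_eq0 expf_neq0 ?(theta_neq0 HC) //.
by rewrite (absV HC) (abs_thetaX HC).
Qed.

(* Linearity makes the logarithmic derivatives Cauchy: the quadratic error is negligible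
   along [s *: delta_mx i 0] as [s] tends to 0. *)
Lemma logdiff_limit c z (f : nat -> 'cV[C]_N -> C) (g : 'cV[C]_N -> C) : 0 < c ->
  (forall d, exists l, logdiff c z (f d) l) -> g z != 0 ->
  (forall eta h, small c eta h -> cvg (fun d => f d (z + h)) (g (z + h))) ->
  exists l, logdiff c z g l.
Proof.
move=> c0 fl gz fg.
have fz : cvg (f^~ z) (g z).
  have := fg 0 0; rewrite addr0; apply; split; first by rewrite lexx ltr01.
  by move=> i; rewrite mxE (abs0 HC) mul0r.
pose l d := epsilon (inhabits (fun=> 0)) (logdiff c z (f d)).
have lP d : logdiff c z (f d) (l d) by exact: epsilon_spec.
have ratio eta h : small c eta h -> cvg (fun d => f d (z + h) / f d z) (g (z + h) / g z).
  by move=> hs; apply: (cvgM HC (fg _ _ hs)); apply: (cvgV HC fz).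
have lC i : exists x, cvg (fun d => l d i) x.
  apply: (C_complete HC) => eps eps0; have e2 := halfr_gt0 eps0.
  (* The first bound on [s] gives [eta < 1], the second gives [eta ^+ 2 <= eps / 2 * absC s], which
     survives division by [s]. *)
  pose m := Num.min (c / 2) (eps / 2 * c ^+ 2).
  have m0 : 0 < m by rewrite lt_min (halfr_gt0 c0) mulr_gt0 ?exprn_gt0.
  have [s [s0 ]] := thetaV_small m0; rewrite lt_min => /andP[sc se].
  have as0 := abs_gt0 HC s0; pose eta := absC s / c.
  have e01 : 0 <= eta < 1.
    rewrite divr_ge0 ?abs_ge0 ?(ltW c0) //= ltr_pdivrMr // mul1r.
    exact: lt_trans sc (halfr_lt c0).
  have hs : small c eta (s *: delta_mx i 0) by apply: small_delta => //; rewrite divfK ?gt_eqF.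
  have tol : eta ^+ 2 <= eps / 2 * absC s.
    rewrite /eta exprMn exprVn ler_pdivrMr ?exprn_gt0 // expr2 mulrAC.
    by rewrite ler_wpM2r ?abs_ge0 // ltW.
  have es0 : 0 < eps / 2 * absC s by rewrite mulr_gt0.
  have [n hn] := cvg_cauchy HC (ratio _ _ hs) es0.
  exists n => d d' nd nd'; apply: le_lt_trans (halfr_lt eps0).
  rewrite -(ler_pM2r as0) -absM mulrBl.
  have [_ k] := (proj2 (lP d)) _ _ hs; have [_ k'] := (proj2 (lP d')) _ _ hs.
  move: k k' (hn d d' nd nd'); rewrite !lin_delta.
  set x := f d _ / _; set x' := f d' _ / _ => k k' k''.
  have -> : l d i * s - l d' i * s =
     (x' - 1 - s * l d' i) - (x - 1 - s * l d i) + (x - x') by ring.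
  apply: (abs_addP HC); last exact: ltW.
  by apply: (abs_subP HC); apply: le_trans tol.
pose L i := epsilon (inhabits 0) (cvg (fun d => l d i)).
have LP i : cvg (fun d => l d i) (L i) by exact: epsilon_spec.
have Llin h : cvg (fun d => lin (l d) h) (lin L h).
  by apply: (cvg_sum HC) => i _; apply: (cvgM HC (LP i) (cvg_cst HC _)).
exists L; split=> // eta h hs; split.
  by apply: (cvg_le HC (N0 := 0%N) (Llin h)) => d _; have [] := (proj2 (lP d)) _ _ hs.
have H := cvgB HC (cvgB HC (ratio _ _ hs) (cvg_cst HC 1)) (Llin h).
by apply: (cvg_le HC (N0 := 0%N) H) => d _; have [] := (proj2 (lP d)) _ _ hs.
Qed.

Lemma logdiff_Delta c z : indep c z -> exists l, logdiff c z (@Defs.Delta _ _ _ iota theta absC r) l.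
Proof.
move=> zc; have [c0 _] := zc; apply: (@logdiff_limit _ _ Delta_approx) => //.
- by move=> d; apply: logdiff_Delta_approx.
- exact: Delta_neq0 zc.
move=> eta h /(indep_near zc) zhc; apply: cvg_ext (Delta_cvg zhc) => d.
by rewrite (Delta_approxE _ zhc).
Qed.

End Discriminant.

(** * Linear independence over K_infinity *)

Section KInfinity.
Variables (F : finFieldType) (C : fieldType) (R : realType).
Variables (iota : {rmorphism F -> C}) (theta : C) (absC : C -> R).
Hypothesis HC : is_Cinfty iota theta absC.
Local Notation A := (Aemb iota theta).
Local Notation cvg := (cvgC absC).
Local Notation abs_ge0 := (abs_ge0 HC).
Local Notation absM := (absM HC).
Local Notation Kinf := (Kinf iota theta absC).

Lemma KinfA a : Kinf (A a).
Proof.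
exists (fun=> a), (fun=> 1); split=> [_|]; first by rewrite rmorph1 oner_neq0.
by apply: cvg_ext (cvg_cst HC _) => n; rewrite rmorph1 divr1.
Qed.

Lemma KinfB x y : Kinf x -> Kinf y -> Kinf (x - y).
Proof.
move=> [a [b [b0 ab]]] [a' [b' [b0' ab']]].
exists (fun n => a n * b' n - a' n * b n), (fun n => b n * b' n); split=> [n|].
  by rewrite rmorphM mulf_neq0 ?b0 ?b0'.
apply: cvg_ext (cvgB HC ab ab') => n; rewrite rmorphB !rmorphM /=.
by field; rewrite b0 b0'.
Qed.

Lemma KinfM x y : Kinf x -> Kinf y -> Kinf (x * y).
Proof.
move=> [a [b [b0 ab]]] [a' [b' [b0' ab']]].
exists (fun n => a n * a' n), (fun n => b n * b' n); split=> [n|].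
  by rewrite rmorphM mulf_neq0 ?b0 ?b0'.
by apply: cvg_ext (cvgM HC ab ab') => n; rewrite !rmorphM /= mulf_div.
Qed.

Lemma KinfV x : Kinf x -> Kinf x^-1.
Proof.
have [->|x0 [a [b [b0 ab]]]] := eqVneq x 0.
  by rewrite invr0 -(rmorph0 A) => _; apply: KinfA.
(* Denominators must be nonzero at every index; [a n] vanishes only at finitely many, where 1 is a
   placeholder. *)
exists b, (fun n => if A (a n) == 0 then 1 else a n); split=> [n|].
  by case: ifPn => // _; rewrite rmorph1 oner_neq0.
have [N h] := cvg_abs HC ab x0.
apply: (cvg_eventually (N0 := N)) (cvgV HC ab x0) => n nN.
rewrite ifF ?invf_div //; apply/negbTE/eqP => a0.
by have := h _ nN; rewrite a0 mul0r (abs0 HC) => /esym/(abs_eq0 HC)/eqP; rewrite (negPf x0).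
Qed.

Lemma Kinf_closed u x : (forall n, Kinf (u n)) -> cvg u x -> Kinf x.
Proof.
move=> Ku ux.
have ap k : exists p : {poly F} * {poly F}, A p.2 != 0 /\ absC (A p.1 / A p.2 - x) < 2 ^- k.
  have e0 : 0 < 2 ^- k :> R by rewrite invr_gt0 exprn_gt0.
  have [n hn] := ux _ e0; have [a [b [b0 ab]]] := Ku n; have [m hm] := ab _ e0.
  exists (a m, b m); split=> //=; apply: (abs_dist_lt HC (y := u n)); first exact: hm _ (leqnn _).
  exact: hn _ (leqnn _).
pose p k := epsilon (inhabits (0, 0))
  (fun p : {poly F} * {poly F} => A p.2 != 0 /\ absC (A p.1 / A p.2 - x) < 2 ^- k).
have pP k : A (p k).2 != 0 /\ absC (A (p k).1 / A (p k).2 - x) < 2 ^- k by exact: (@epsilon_spec _ _ _ (ap k)).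
exists (fun k => (p k).1), (fun k => (p k).2); split=> [k|e e0]; first by have [] := pP k.
have [k0 hk] := geom_small (lexx 2) e0; exists k0 => k kk.
have [_ h] := pP k; apply: lt_trans h _; apply: le_lt_trans hk.
by rewrite lef_pV2 ?posrE ?exprn_gt0 // ler_weXn2l // ler1n.
Qed.

(* Norm equivalence on finite-dimensional spaces over the complete field K_infinity: the span
   of the first [k] vectors is complete, so the next vector has positive distance to it. *)
Lemma Kinf_free_bound (w : nat -> C) k :
  (forall a : nat -> C, (forall i, Kinf (a i)) -> \sum_(i < k) a i * w i = 0 ->
    forall i, (i < k)%N -> a i = 0) ->
  exists2 delta : R, 0 < delta & forall a : nat -> C, (forall i, Kinf (a i)) ->
    forall i, (i < k)%N -> delta * absC (a i) <= absC (\sum_(i < k) a i * w i).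
Proof.
have K0 : Kinf 0 by rewrite -(rmorph0 A); apply: KinfA.
elim: k => [_|k IH free]; first by exists 1 => // ? ? i.
have [a Ka e0 i ik|delta d0 hd] := IH.
  have := free (fun j => if (j < k)%N then a j else 0) _ _ i (leqW ik).
  rewrite ik; apply=> [j|]; first by case: ifP.
  rewrite big_ord_recr /= ltnn mul0r addr0 -[RHS]e0; apply: eq_bigr => j _.
  by rewrite ltn_ord.
(* Otherwise a minimizing sequence has Cauchy coefficients by [hd], and their limits give a relation
   where [w k] has coefficient 1. *)
have [eps eps0 he] : exists2 eps : R, 0 < eps & forall a : nat -> C, (forall i, Kinf (a i)) ->
    eps <= absC (\sum_(i < k) a i * w i + w k).
  apply: NNPP => hn.
  have bad n : exists a : nat -> C, (forall i, Kinf (a i)) /\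
      absC (\sum_(i < k) a i * w i + w k) < 2 ^- n.
    apply: NNPP => hb; apply: hn; exists (2 ^- n); first by rewrite invr_gt0 exprn_gt0.
    move=> a Ka; rewrite leNgt; apply/negP => h; apply: hb; by exists a.
  pose a n := epsilon (inhabits (fun=> 0)) (fun a : nat -> C => (forall i, Kinf (a i)) /\
      absC (\sum_(i < k) a i * w i + w k) < 2 ^- n).
  have aP n : (forall i, Kinf (a n i)) /\ absC (\sum_(i < k) a n i * w i + w k) < 2 ^- n.
    exact: (@epsilon_spec _ _ _ (bad n)).
  have aS e : 0 < e -> exists n0, forall n, (n0 <= n)%N ->
      absC (\sum_(i < k) a n i * w i + w k) < e.
    move=> e0; have [n0 hn0] := geom_small (lexx 2) e0; exists n0 => n nn.
    have [_ h] := aP n; apply: lt_trans h _; apply: le_lt_trans hn0.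
    by rewrite lef_pV2 ?posrE ?exprn_gt0 // ler_weXn2l // ler1n.
  have aC i : (i < k)%N -> exists l, cvg (fun n => a n i) l.
    move=> ik; apply: (C_complete HC) => e e0.
    have [n0 hn0] := aS _ (mulr_gt0 d0 e0).
    exists n0 => m n hm hnn; rewrite -(ltr_pM2l d0).
    have Kd j : Kinf (a m j - a n j) by apply: KinfB; apply: (proj1 (aP _)).
    apply: le_lt_trans (hd _ Kd i ik) _.
    have -> : \sum_(j < k) (a m j - a n j) * w j =
      (\sum_(j < k) a m j * w j + w k) - (\sum_(j < k) a n j * w j + w k).
      rewrite opprD addrACA subrr addr0 -sumrB; apply: eq_bigr => j _.
      by rewrite mulrBl.
    by apply: (abs_add_lt HC); rewrite ?(absN HC) hn0.
  (* The default value 1 serves as the coefficient of [w k]. *)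
  pose l i := if (i < k)%N then epsilon (inhabits 0) (cvg (fun n => a n i)) else 1.
  have lP i : (i < k)%N -> cvg (fun n => a n i) (l i).
    by move=> ik; rewrite /l ik; apply: epsilon_spec; apply: aC.
  have Kl i : Kinf (l i).
    have [ik|ik] := ltnP i k.
      by apply: (Kinf_closed _ (lP i ik)) => n; have [h _] := aP n; apply: h.
    by rewrite /l ltnNge ik /= -(rmorph1 A); apply: KinfA.
  have := free l Kl; rewrite big_ord_recr /= {2}/l ltnn mul1r => h.
  have /h/(_ k (ltnSn k))/eqP : \sum_(i < k) l i * w i + w k = 0; last first.
    by rewrite /l ltnn oner_eq0.
  apply: (cvg_uniq HC (u := fun n => \sum_(i < k) a n i * w i + w k)).
    apply: (cvgD HC) (cvg_cst HC _); apply: (cvg_sum HC) => i _.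
    exact: (cvgM HC (lP _ (ltn_ord i)) (cvg_cst HC _)).
  by move=> e /aS[n0 hn0]; exists n0 => n nn; rewrite subr0 hn0.
(* [B] bounds the earlier part [s] by the whole sum, by writing [s] as the sum minus [a k * w k] and
   using [last]. *)
pose B := 1 + absC (w k) / eps; have B0 : 0 < B.
  by rewrite ltr_pwDl // divr_ge0 ?abs_ge0 ?(ltW eps0).
have B1 : 1 <= B by rewrite lerDl divr_ge0 ?abs_ge0 ?(ltW eps0).
have wB : absC (w k) / eps <= B by rewrite lerDr.
exists (Num.min eps (delta / B)); first by rewrite lt_min eps0 divr_gt0.
move=> a Ka i; rewrite big_ord_recr /=; set s := \sum_(i < k) _.
have last : eps * absC (a k) <= absC (s + a k * w k).
  have [->|ak0] := eqVneq (a k) 0; first by rewrite (abs0 HC) mulr0 abs_ge0.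
  have := he (fun j => a j / a k) (fun j => KinfM (Ka j) (KinfV (Ka k))).
  move=> /(ler_wpM2r (abs_ge0 (a k))) /le_trans; apply; rewrite -absM mulrDl mulr_suml.
  rewrite [w k * _]mulrC (eq_bigr (fun j : 'I_k => a j * w j)) // => j _.
  by rewrite mulrAC divfK.
rewrite ltnS leq_eqVlt => /predU1P[->|ik].
  by apply: le_trans last; rewrite ler_wpM2r ?abs_ge0 // ge_min lexx.
have sB : absC s <= B * absC (s + a k * w k).
  rewrite -(addrK (a k * w k) s); apply: (abs_subP HC).
    by rewrite addrK ler_peMl ?abs_ge0.
  rewrite addrK absM; apply: le_trans (ler_wpM2r (abs_ge0 _) wB).
  rewrite mulrAC ler_pdivlMr // mulrC mulrA [_ * absC (w k)]mulrC ler_wpM2l ?abs_ge0 //.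
apply: (@le_trans _ _ (delta / B * absC (a i))).
  by rewrite ler_wpM2r ?abs_ge0 // ge_min lexx orbT.
rewrite mulrAC ler_pdivrMr // [_ * B]mulrC; apply: le_trans sB.
exact: hd.
Qed.

Lemma Omega_indep r (z : 'cV[C]_r.+1) : Omega iota theta absC z ->
  exists c, indep iota theta absC c z.
Proof.
move=> [_ free]; have [|c c0 h] := @Kinf_free_bound (fun i => z (inord i) 0) r.+1.
  move=> a Ka e i ir; have -> : i = (inord i : 'I_r.+1) by rewrite inordK.
  apply: (free (fun i : 'I_r.+1 => a i)) => [j|]; first exact: Ka.
  by rewrite -[RHS]e; apply: eq_bigr => j _; rewrite inord_val.
exists c; split=> // b i.
have := h (fun i => A (b 0 (inord i))) (fun i => KinfA _) i (ltn_ord i).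
rewrite inord_val => /le_trans; apply; rewrite le_eqVlt; apply/orP; left; apply/eqP.
by congr absC; apply: eq_bigr => j _; rewrite !inord_val.
Qed.

End KInfinity.

(** * Modularity *)

Section Modularity.
Variables (F : finFieldType) (C : fieldType) (R : realType).
Variables (iota : {rmorphism F -> C}) (theta : C) (absC : C -> R).
Hypothesis HC : is_Cinfty iota theta absC.
Variable r : nat.
Local Notation q := #|F|.
Local Notation A := (Aemb iota theta).
Local Notation N := r.+1.
Local Notation abs_ge0 := (abs_ge0 HC).
Local Notation absM := (absM HC).
Local Notation dot := (dot iota theta).
Local Notation indep := (indep iota theta absC).
Local Notation disc := (@Defs.Delta F C R iota theta absC r).
Implicit Types (z h w : 'cV[C]_N) (b : 'rV[{poly F}]_N) (c eta : R).

(** Uniqueness of the limit rests on nonzero increments of arbitrarily small size, supplied by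
    powers of theta^-1. *)
Lemma pderivE (f : 'cV[C]_N -> C) z j x : is_pderiv absC f z j x -> pderiv absC f z j = x.
Proof.
move=> fx; have fy : is_pderiv absC f z j (pderiv absC f z j).
  by apply: epsilon_spec; exists x.
apply: (eq_of_small HC) => e e0.
have [d1 [d10 h1]] := fx e e0; have [d2 [d20 h2]] := fy e e0.
have d0 : 0 < Num.min d1 d2 by rewrite lt_min d10.
have [s [s0]] := thetaV_small HC d0; rewrite lt_min => /andP[/(h1 _ s0) k1 /(h2 _ s0) k2].
apply: (abs_distP HC (y := (f (z + s *: delta_mx j 0) - f z) / s)); last exact: ltW.
by rewrite (abs_distC HC) ltW.
Qed.

Lemma vec_bound w : exists2 W : R, 0 < W & forall i, absC (w i 0) <= W.
Proof.
exists (1 + \sum_i absC (w i 0)).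
  by rewrite ltr_wpDr // sumr_ge0 // => i _; apply: abs_ge0.
move=> i; rewrite (bigD1 i) //= addrCA lerDl addr_ge0 // sumr_ge0 // => j _.
exact: abs_ge0.
Qed.

Lemma small_scale c w W s : 0 < c -> 0 < W -> (forall i, absC (w i 0) <= W) ->
  absC s < c / W -> small absC c (absC s * W / c) (s *: w).
Proof.
move=> c0 W0 hW sc; split; last first.
  by move=> i; rewrite divfK ?gt_eqF // mxE absM ler_wpM2l ?abs_ge0.
rewrite divr_ge0 ?mulr_ge0 ?abs_ge0 ?(ltW W0) ?(ltW c0) //=.
by rewrite ltr_pdivrMr // mul1r -ltr_pdivlMr.
Qed.

Lemma logdiff_dir c z l w : 0 < c -> logdiff absC c z disc l ->
  forall e : R, 0 < e -> exists2 del : R, 0 < del & forall s, s != 0 -> absC s < del ->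
    absC ((disc (z + s *: w) - disc z) / s - disc z * lin l w) < e.
Proof.
move=> c0 [D0 H] e e0; have [W W0 hW] := vec_bound w.
have aD := abs_gt0 HC D0.
(* Dividing the remainder [(absC s * W / c) ^+ 2] by [s] and multiplying by [disc z] leaves
   [absC s * K]. *)
pose K := absC (disc z) * (W / c) ^+ 2; have K0 : 0 < K by rewrite mulr_gt0 ?exprn_gt0 ?divr_gt0.
exists (Num.min (c / W) (e / K)); first by rewrite lt_min !divr_gt0.
move=> s s0; rewrite lt_min => /andP[sc se].
have [_] := H _ _ (small_scale c0 W0 hW sc); rewrite linZ.
have as0 := abs_gt0 HC s0.
set rho := disc (z + _) / _ => k.
have -> : (disc (z + s *: w) - disc z) / s - disc z * lin l w =
    disc z / s * (rho - 1 - s * lin l w) by rewrite /rho; field; rewrite s0 D0.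
rewrite absM absM (absV HC).
have p0 : 0 <= absC (disc z) / absC s by rewrite divr_ge0 ?abs_ge0.
apply: le_lt_trans (ler_wpM2l p0 k) _.
have -> : absC (disc z) / absC s * (absC s * W / c) ^+ 2 = absC s * K.
  by rewrite /K; field; rewrite !gt_eqF.
by rewrite -ltr_pdivlMr.
Qed.

Lemma inLattice_mul (gamma : 'M[{poly F}]_N) z x : gamma \in unitmx ->
  inLattice iota theta (map_mx A gamma *m z) x <-> inLattice iota theta z x.
Proof.
move=> gu; have dotE b : dot (map_mx A gamma *m z) b = dot z (b *m gamma).
  rewrite /dot (eq_bigr (fun i => \sum_j A (b 0 i) * A (gamma i j) * z j 0)); last first.
    by move=> i _; rewrite mxE mulr_sumr; apply: eq_bigr => j _; rewrite mxE mulrA.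
  rewrite exchange_big; apply: eq_bigr => j _; rewrite mxE rmorph_sum mulr_suml.
  by apply: eq_bigr => i _; rewrite rmorphM.
split=> /inLatticeP[b ->]; apply/inLatticeP.
  by exists (b *m gamma).
by exists (b *m invmx gamma); rewrite dotE mulmxKV.
Qed.

Lemma inLattice_scale z t x : t != 0 ->
  inLattice iota theta (t *: z) x <-> inLattice iota theta z (t^-1 * x).
Proof.
move=> t0; have dotE b : dot (t *: z) b = t * dot z b.
  by rewrite /dot mulr_sumr; apply: eq_bigr => i _; rewrite mxE mulrCA.
split=> /inLatticeP[b e]; apply/inLatticeP; exists b.
  by rewrite e dotE mulKf.
by rewrite dotE -e mulVKf.
Qed.

(* Euler's relation for the homogeneous function [disc], of degree 1 - q^N = 1 in [C]. *)
Lemma lin_Euler c z l : indep c z -> logdiff absC c z disc l -> lin l z = 1.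
Proof.
move=> zc H; have [D0 K] := H; have [c0 _] := zc; have [W W0 hW] := vec_bound z.
apply: (eq_of_small HC) => e e0.
(* [M] covers two errors of order [absC s ^+ 2]: the remainder of [logdiff], and [s ^+ (q ^ N)]. *)
pose M := 1 + (W / c) ^+ 2.
have M0 : 0 < M by rewrite ltr_wpDr // exprn_ge0 // divr_ge0 ?ltW.
have d0 : 0 < Num.min (c / W) (Num.min 1 (e / M)) by rewrite !lt_min !divr_gt0 ?ltr01.
have [s [s0]] := thetaV_small HC d0; rewrite !lt_min => /and3P[sc s1 se].
have hs := small_scale c0 W0 hW sc; have [_] := K _ _ hs; rewrite linZ.
have rho1 := logdiff_le HC H hs; have as0 := abs_gt0 HC s0.
set rho := disc (z + _) / _ in rho1 * => k.
have arho : absC rho <= 1.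
  rewrite -(subrK 1 rho); apply: (abs_addP HC); last by rewrite (abs1 HC).
  by apply: le_trans rho1 _; case: hs => /andP[_ /ltW].
have t0 : 1 + s != 0 by apply: (abs_neq0 HC); rewrite (abs_1D HC).
have ti0 : (1 + s)^-1 != 0 by rewrite invr_eq0.
have zz x : inLattice iota theta (z + s *: z) x <-> inLattice iota theta z ((1 + s)^-1 * x).
  by rewrite -{1}[z]scale1r -scalerDl; apply: inLattice_scale.
have := Delta_scale HC zc ti0 zz; rewrite exprVn.
(* By Frobenius the degree -q^N part of the scaling factor differs from 1 only beyond first
   order. *)
have -> : (1 + s) ^+ (q ^ N) = 1 + s ^+ (q ^ N) by rewrite (frobD iota) expr1n.
set S := s ^+ (q ^ N) => E.
have S1 : absC S < 1 by rewrite /S (absX HC) exprn_ilt1 ?abs_ge0 // expn_eq0 gtn_eqF ?(ltnW (q_gt1 F)).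
have T0 : 1 + S != 0 by apply: (abs_neq0 HC); rewrite (abs_1D HC).
have rhoE : rho * (1 + S) = 1 + s.
  have -> : rho = disc (z + s *: z) * (1 + s)^-1 * (1 + s) / disc z by rewrite /rho; field; rewrite D0 t0.
  by rewrite E; field; rewrite D0 T0.
rewrite -(ler_pM2r as0) -absM.
have -> : (lin l z - 1) * s = - (rho - 1 - s * lin l z) - rho * S.
  have -> : rho * S = 1 + s - rho by rewrite -rhoE; ring.
  ring.
have tol : absC s ^+ 2 * M <= e * absC s.
  by rewrite expr2 -mulrA [e * _]mulrC ler_wpM2l ?abs_ge0 // ltW // -ltr_pdivlMr.
have s20 : 0 <= absC s ^+ 2 by rewrite exprn_ge0 ?abs_ge0.
apply: le_trans tol; apply: (abs_subP HC).
  rewrite (absN HC); apply: le_trans k _.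
  have -> : (absC s * W / c) ^+ 2 = absC s ^+ 2 * (W / c) ^+ 2 by field; rewrite gt_eqF.
  by rewrite ler_wpM2l // /M lerDr.
rewrite absM; apply: (@le_trans _ _ (1 * absC s ^+ 2)).
  apply: ler_pM; rewrite ?abs_ge0 // /S (absX HC) ler_wiXn2l ?abs_ge0 ?(ltW s1) //.
  by rewrite expnS (leq_trans (q_gt1 F)) // leq_pmulr // expn_gt0 (ltnW (q_gt1 F)).
rewrite mul1r ler_peMr // /M lerDl exprn_ge0 // divr_ge0 ?ltW //.
Qed.

Lemma jfac_neq0 c z (gamma : 'M[{poly F}]_N) : indep c z -> gamma \in unitmx ->
  jfac iota theta gamma z != 0.
Proof.
move=> zc gu; have -> : jfac iota theta gamma z = dot z (row ord_max gamma).
  by rewrite /jfac mxE; apply: eq_bigr => i _; rewrite !mxE.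
apply: (dot_neq0 HC zc); apply/eqP => e0.
have : row ord_max (1%:M : 'M[{poly F}]_N) = 0 by rewrite -(mulmxV gu) row_mul e0 mul0mx.
by move/rowP/(_ ord_max); rewrite !mxE eqxx => /eqP; rewrite oner_eq0.
Qed.

(** The scalar [t] does not vary with [h]: taking it to be j(gamma,z) keeps the perturbation of [z]
    linear. *)
Lemma disc_act c z h (gamma : 'M[{poly F}]_N) (t : C) : indep c (z + h) -> gamma \in unitmx ->
  t != 0 -> disc (t^-1 *: (map_mx A gamma *m (z + h))) = t ^+ (q ^ N) / t * disc (z + h).
Proof.
move=> zc gu t0; apply: (mulIf t0).
have -> : t ^+ (q ^ N) / t * disc (z + h) * t = t ^+ (q ^ N) * disc (z + h) by field.
apply: (Delta_scale HC zc t0) => x.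
rewrite inLattice_scale ?invr_eq0 // invrK; exact: inLattice_mul.
Qed.

Lemma logdiff_act c z l (gamma : 'M[{poly F}]_N) : indep c z -> logdiff absC c z disc l ->
  gamma \in unitmx ->
  (disc (act iota theta gamma z))^-1 * pderiv absC disc (act iota theta gamma z) ord0 =
  (A (\det gamma))^-1 * jfac iota theta gamma z * \sum_i l i * A (cofactor gamma 0 i).
Proof.
move=> zc H gu; have [c0 _] := zc; set j := jfac iota theta gamma z.
have j0 : j != 0 := jfac_neq0 zc gu.
pose G := map_mx A gamma; have Gu : G \in unitmx.
  by rewrite unitmxE det_map_mx; apply: rmorph_unit; rewrite -unitmxE.
(* Chosen so that [j^-1 *: (G *m (z + s *: w))] is [act gamma z] moved by [s] along the first
   coordinate. *)
pose w : 'cV[C]_N := j *: (invmx G *m delta_mx 0 0).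
have [W W0 hW] := vec_bound w.
have D0 : disc z != 0 by case: H.
have actE s : absC s < c / W ->
    disc (act iota theta gamma z + s *: delta_mx 0 0) = j ^+ (q ^ N) / j * disc (z + s *: w).
  move=> sc; rewrite -(disc_act (indep_near HC zc (small_scale c0 W0 hW sc)) gu j0).
  congr disc; rewrite mulmxDr scalerDr /act -/j; congr (_ + _).
  rewrite /w -!scalemxAr mulmxA mulmxV // mul1mx !scalerA; congr (_ *: _).
  by field.
have act0 : disc (act iota theta gamma z) = j ^+ (q ^ N) / j * disc z.
  by have := actE 0; rewrite !scale0r !addr0; apply; rewrite (abs0 HC) divr_gt0.
have T0 : j ^+ (q ^ N) != 0 by rewrite expf_neq0.
pose J := j ^+ (q ^ N) / j; have J0 : J != 0 by rewrite mulf_neq0 ?invr_eq0.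
rewrite (@pderivE _ _ _ (J * (disc z * lin l w))); last first.
  move=> e e0; have [del del0 hd] := logdiff_dir w c0 H (divr_gt0 e0 (abs_gt0 HC J0)).
  exists (Num.min (c / W) del); split; first by rewrite lt_min divr_gt0.
  move=> s s0; rewrite lt_min => /andP[sc sd]; rewrite actE // act0 -/J.
  have -> : (J * disc (z + s *: w) - J * disc z) / s - J * (disc z * lin l w) =
    J * ((disc (z + s *: w) - disc z) / s - disc z * lin l w) by field.
  by rewrite absM mulrC -ltr_pdivlMr ?(abs_gt0 HC) // hd.
rewrite act0 -/J.
have -> : (J * disc z)^-1 * (J * (disc z * lin l w)) = lin l w by field; rewrite J0 D0.
rewrite /w linZ -mulrA mulrCA; congr (_ * _).
rewrite /lin mulr_sumr; apply: eq_bigr => i _; rewrite mulrCA; congr (_ * _).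
(* The first column of the inverse consists of the first-row cofactors divided by the
   determinant. *)
rewrite /invmx Gu -scalemxAl mxE det_map_mx; congr (_ * _).
rewrite -map_mx_adj mxE (bigD1 0) //= big1 => [|k k0].
  by rewrite !mxE eqxx mulr1 addr0.
by rewrite !mxE (negPf k0) mulr0.
Qed.

End Modularity.

(* rank r = n.+2 >= 2 *)
Theorem theorem4p1 (F : finFieldType) (C : fieldType) (R : realType)
  (iota : {rmorphism F -> C}) (theta : C) (absC : C -> R)
  (HC : is_Cinfty iota theta absC)
  (zeta : C) (Hzeta : zeta ^+ (#|F|.-1) = - theta)
  (n : nat) (z : 'cV[C]_(n.+2)) (Hz : Omega iota theta absC z)
  (gamma : 'M[{poly F}]_(n.+2)) (Hgamma : gamma \in unitmx) :
  Ej iota theta absC zeta (act iota theta gamma z) ord0 =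
  (Aemb iota theta (\det gamma))^-1 * jfac iota theta gamma z *
  (\sum_(j < n.+2 | j != ord_max)
      Ej iota theta absC zeta z j *
      (Aemb iota theta (cofactor gamma 0 j)
       - z j 0 * Aemb iota theta (cofactor gamma 0 ord_max))
   + (pitilde F theta absC zeta)^-1 * Aemb iota theta (cofactor gamma 0 ord_max)).
Proof.
have [c zc] := Omega_indep HC Hz; have [c0 _] := zc.
have [l H] := logdiff_Delta HC zc; have [D0 _] := H.
have EjE j : Ej iota theta absC zeta z j = (pitilde F theta absC zeta)^-1 * l j.
  rewrite /Ej -mulrA; congr (_ * _).
  rewrite (pderivE HC (x := Delta iota theta absC z * l j)) ?mulKf // => e e0.
  have [del del0 hd] := logdiff_dir HC (delta_mx j 0) c0 H e0.
  exists del; split=> // s s0 /(hd _ s0).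
  by rewrite -[delta_mx j 0]scale1r lin_delta mul1r scale1r.
rewrite {1}/Ej -mulrA (logdiff_act HC zc H Hgamma) mulrCA; congr (_ * _).
under [in RHS]eq_bigr => j _ do rewrite EjE -mulrA.
rewrite -mulr_sumr -mulrDr; congr (_ * _).
(* With last entry of [z] equal to 1, Euler's relation expresses [l ord_max] through the other
   derivatives; this produces the terms [- z j 0] and the final cofactor. *)
have := lin_Euler HC zc H; rewrite /lin (bigD1 ord_max) //=.
have [-> _] := Hz; rewrite mulr1 => lmax.
rewrite (bigD1 ord_max) //= addrC.
under [in RHS]eq_bigr => j _ do rewrite mulrBr mulrA.
have -> : l ord_max = 1 - \sum_(i < n.+2 | i != ord_max) l i * z i 0 by rewrite -lmax addrK.
by rewrite sumrB -mulr_suml; ring.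
Qed.
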